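(* Let $a<b$, $c<d$. For any $B\in\mathcal N_{011}\left[\begin{smallmatrix}n_0&p_0\\ n_1&p_1\end{smallmatrix}\right]$ and $D\in\mathcal N_{011}\left[\begin{smallmatrix}p_0&m_0\\ p_1&m_1\end{smallmatrix}\right]$ there exists a unique $R\in\mathcal N_{011}\left[\begin{smallmatrix}n_0&m_0\\ n_1&m_1\end{smallmatrix}\right]$ such that $\mathcal P[B]\mathcal P[D]=\mathcal P[R]$. Specifically, we may choose $R=\mathcal L_{011}(B,D)\in\mathcal N_{011}\left[\begin{smallmatrix}n_0&m_0\\ n_1&m_1\end{smallmatrix}\right]$, where the linear parameter map $\mathcal L_{011}:\mathcal N_{011}\left[\begin{smallmatrix}n_0&p_0\\ n_1&p_1\end{smallmatrix}\right]\times\mathcal N_{011}\left[\begin{smallmatrix}p_0&m_0\\ p_1&m_1\end{smallmatrix}\right]\to\mathcal N_{011}\left[\begin{smallmatrix}n_0&m_0\\ n_1&m_1\end{smallmatrix}\right]$ is given by (with $\eta$ ranging over $[a,b]$ and $\mu$ over $[c,d]$) $$\begin{aligned} R_{00}&=B_{00}D_{00}+\int_a^bB_{01}(\eta)D_{10}(\eta)d\eta+\int_c^dB_{02}(\mu)D_{20}(\mu)d\mu,\\ R_{01}(\theta)&=B_{00}D_{01}(\theta)+\int_a^bB_{01}(\eta)\sum_{i=0}^2\Phi_i(\eta,\theta)D_{11}^i(\eta,\theta)d\eta+\int_c^dB_{02}(\mu)D_{21}(\mu,\theta)d\mu,\\ R_{02}(\nu)&=B_{00}D_{02}(\nu)+\int_a^bB_{01}(\eta)D_{12}(\eta,\nu)d\eta+\int_c^dB_{02}(\mu)\sum_{i=0}^2\Phi_i(\mu,\nu)D_{22}^i(\mu,\nu)d\mu,\\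 R_{10}(x)&=B_{10}(x)D_{00}+\int_a^b\sum_{i=0}^2\Phi_i(x,\eta)B_{11}^i(x,\eta)D_{10}(\eta)d\eta+\int_c^dB_{12}(x,\mu)D_{20}(\mu)d\mu,\\ R_{12}(x,\nu)&=B_{10}(x)D_{02}(\nu)+\int_a^b\sum_{i=0}^2\Phi_i(x,\eta)B_{11}^i(x,\eta)D_{12}(\eta,\nu)d\eta+\int_c^dB_{12}(x,\mu)\sum_{i=0}^2\Phi_i(\mu,\nu)D_{22}^i(\mu,\nu)d\mu,\\ R_{20}(y)&=B_{20}(y)D_{00}+\int_a^bB_{21}(y,\eta)D_{10}(\eta)d\eta+\int_c^d\sum_{i=0}^2\Phi_i(y,\mu)B_{22}^i(y,\mu)D_{20}(\mu)d\mu,\\ R_{21}(y,\theta)&=B_{20}(y)D_{01}(\theta)+\int_a^bB_{21}(y,\eta)\sum_{i=0}^2\Phi_i(\eta,\theta)D_{11}^i(\eta,\theta)d\eta+\int_c^d\sum_{i=0}^2\Phi_i(y,\mu)B_{22}^i(y,\mu)D_{21}(\mu,\theta)d\mu, \end{aligned}$$ and, for $k\in\{0,1,2\}$, with $\epsilon_0=0$, $\epsilon_1=\epsilon_2=1$, $$\begin{aligned} R_{11}^k(x,\theta)&=\int_a^b\sum_{i,j=0}^2\Psi_{kij}(x,\eta,\theta)B_{11}^i(x,\eta)D_{11}^j(\eta,\theta)d\eta+\epsilon_k\Big[B_{10}(x)D_{01}(\theta)+\int_c^dB_{12}(x,\mu)D_{21}(\mu,\theta)d\mu\Big],\\ R_{22}^k(y,\nu)&=\int_c^d\sum_{i,j=0}^2\Psi_{kij}(y,\mu,\nu)B_{22}^i(y,\mu)D_{22}^j(\mu,\nu)d\mu+\epsilon_k\Big[B_{20}(y)D_{02}(\nu)+\int_a^bB_{21}(y,\eta)D_{12}(\eta,\nu)d\eta\Big].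 \end{aligned}$$
   Context: Throughout $x,\theta\in[a,b]$ and $y,\nu\in[c,d]$. $\mathcal N_{1D}^{n\times m}$: triples $N=\{N_0,N_1,N_2\}$ of $\mathbb R^{n\times m}$-valued $L_2$ functions $N_0(s)$, $N_1(s,\sigma)$, $N_2(s,\sigma)$ on an interval $[\alpha,\beta]$ (either $[a,b]$ or $[c,d]$), with operator $(\mathcal P[N]u)(s)=N_0(s)u(s)+\int_\alpha^sN_1(s,\sigma)u(\sigma)d\sigma+\int_s^\beta N_2(s,\sigma)u(\sigma)d\sigma$. When $N_0$ is written with two arguments it does not depend on the second. $\mathcal N_{011}\left[\begin{smallmatrix}n_0&m_0\\ n_1&m_1\end{smallmatrix}\right]$: $3\times3$ arrays $B=(B_{ij})_{i,j\in\{0,1,2\}}$ with $B_{00}\in\mathbb R^{n_0\times m_0}$; $B_{01}\in L_2^{n_0\times m_1}[x]$, $B_{02}\in L_2^{n_0\times m_1}[y]$; $B_{10}\in L_2^{n_1\times m_0}[x]$, $B_{20}\in L_2^{n_1\times m_0}[y]$; $B_{12}\in L_2^{n_1\times m_1}[x,y]$, $B_{21}\in L_2^{n_1\times m_1}[y,x]$; $B_{11}=\{B_{11}^0,B_{11}^1,B_{11}^2\}\in\mathcal N_{1D}^{n_1\times m_1}$ on $[a,b]$ and $B_{22}=\{B_{22}^0,B_{22}^1,B_{22}^2\}\in\mathcal N_{1D}^{n_1\times m_1}$ on $[c,d]$. The 011-PI operator $\mathcal P[B]:\mathbb R^{m_0}\times L_2^{m_1}[x]\times L_2^{m_1}[y]\to\mathbb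 R^{n_0}\times L_2^{n_1}[x]\times L_2^{n_1}[y]$ maps $(u_0,u_1,u_2)$ to $(v_0,v_1,v_2)$ with $v_0=B_{00}u_0+\int_a^bB_{01}(x)u_1(x)dx+\int_c^dB_{02}(y)u_2(y)dy$, $v_1(x)=B_{10}(x)u_0+(\mathcal P[B_{11}]u_1)(x)+\int_c^dB_{12}(x,y)u_2(y)dy$, $v_2(y)=B_{20}(y)u_0+\int_a^bB_{21}(y,x)u_1(x)dx+(\mathcal P[B_{22}]u_2)(y)$. Kernels. On an interval $[\alpha,\beta]$ (equal to $[a,b]$ or $[c,d]$ according to the variables), let $\delta(s,\sigma)=\delta(\sigma,s)$ be the Dirac delta, $\int_\alpha^\beta\delta(s,\sigma)f(\sigma)d\sigma=f(s)$; let $I(s,\sigma)=1$ if $\sigma<s$ and $0$ otherwise; let $H(s,\sigma,\tau)=1$ if $\tau<\sigma<s$ and $0$ otherwise. Then $\Phi_0(s,\sigma)=\delta(s,\sigma)$, $\Phi_1(s,\sigma)=I(s,\sigma)$, $\Phi_2(s,\sigma)=I(\sigma,s)$; and $\Psi_{kij}(s,\sigma,\tau)$ is: $\delta(s,\sigma)$ for $kij=000,101,202$; $\delta(\tau,\sigma)$ for $kij=110,220$; $H(s,\sigma,\tau)$ for $111$; $H(\tau,\sigma,s)$ for $222$; $I(\tau,\sigma)$ for $112$; $I(s,\sigma)$ for $212$; $I(\sigma,s)$ for $121$; $I(\sigma,\tau)$ for $221$; and $0$ for all other $kij\in\{0,1,2\}^3$.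
   Formalization: P[B] and P[D] are assumed to map R×L_2×L_2 to itself (false for general L_2 multipliers B_11^0, B_22^0, e.g. s^(-1/3)); uniqueness of R_11, R_22 is a.e., with N_1 compared only for σ<s and N_2 only for σ>s; ''linear'' means linear in each argument. *)

(* Defs.v *)
(* MathComp / MathComp-Analysis. *)
From HB Require Import structures.
From mathcomp Require Import all_boot all_order all_algebra.
From mathcomp Require Import all_classical all_reals all_analysis.
Set Implicit Arguments.
Unset Strict Implicit.
Unset Printing Implicit Defensive.
Import Order.TTheory GRing.Theory Num.Theory.
Import numFieldNormedType.Exports.
Local Open Scope classical_set_scope.
Local Open Scope ring_scope.

(* Elements of L_2 are handled through representatives: total functions, of
   which only the values on the relevant interval or rectangle matter; they are
   compared by [ae_eq].  Matrix-valued functions are integrated and tested for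
   membership in L_2 entrywise. *)

Definition L2_on (R : realType) n m (a b : R) (F : R -> 'M[R]_(n, m)) : Prop :=
  forall i j,
    (fun s => F s i j) \_ `[a, b] \in Lfun (@lebesgue_measure R) 2%:E.

Definition L2_on2 (R : realType) n m (a b c d : R)
    (F : R -> R -> 'M[R]_(n, m)) : Prop :=
  forall i j,
    (fun z : R * R => F z.1 z.2 i j) \_ (`[a, b] `*` `[c, d])
      \in Lfun (@lebesgue_measure R \x @lebesgue_measure R)%E 2%:E.

Definition mxint (R : realType) n m (A : set R) (F : R -> 'M[R]_(n, m)) :
    'M[R]_(n, m) :=
  \matrix_(i, j) \int[@lebesgue_measure R]_(s in A) F s i j.

Record par1D (R : realType) (n m : nat) := Par1D {
  N0 : R -> 'M[R]_(n, m);
  N1 : R -> R -> 'M[R]_(n, m);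
  N2 : R -> R -> 'M[R]_(n, m) }.

(* [ker N k s sigma] is N_k(s, sigma); N_0 does not depend on sigma. *)
Definition ker (R : realType) n m (N : par1D R n m) (k : nat) (s sigma : R) :
    'M[R]_(n, m) :=
  match k with 0 => N0 N s | 1 => N1 N s sigma | _ => N2 N s sigma end.

Definition in_N1D (R : realType) n m (a b : R) (N : par1D R n m) : Prop :=
  [/\ L2_on a b (N0 N), L2_on2 a b a b (N1 N) & L2_on2 a b a b (N2 N)].

Definition P1D (R : realType) n m (a b : R) (N : par1D R n m)
    (u : R -> 'cV[R]_m) (s : R) : 'cV[R]_n :=
  N0 N s *m u s + mxint `[a, s] (fun sigma => N1 N s sigma *m u sigma)
                + mxint `[s, b] (fun sigma => N2 N s sigma *m u sigma).

(* P[N] only involves N_1(s, sigma) for sigma < s and N_2(s, sigma) for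
   s < sigma, so that is where these parameters are compared. *)
Definition eq_N1D (R : realType) n m (a b : R) (N N' : par1D R n m) : Prop :=
  let mu := @lebesgue_measure R in
  let lower := [set z : R * R |
    [/\ z.1 \in `[a, b], z.2 \in `[a, b] & z.2 < z.1]] in
  let upper := [set z : R * R |
    [/\ z.1 \in `[a, b], z.2 \in `[a, b] & z.1 < z.2]] in
  [/\ ae_eq mu [set` `[a, b]] (N0 N) (N0 N'),
      ae_eq (mu \x mu)%E lower (fun z => N1 N z.1 z.2) (fun z => N1 N' z.1 z.2)
    & ae_eq (mu \x mu)%E upper (fun z => N2 N z.1 z.2)
                               (fun z => N2 N' z.1 z.2)].

Definition lin1D (R : realType) n m (k : R) (N N' : par1D R n m) :
    par1D R n m :=
  Par1D (fun s => k *: N0 N s + N0 N' s)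
        (fun s sigma => k *: N1 N s sigma + N1 N' s sigma)
        (fun s sigma => k *: N2 N s sigma + N2 N' s sigma).

Record par011 (R : realType) (n0 m0 n1 m1 : nat) := Par011 {
  B00 : 'M[R]_(n0, m0);
  B01 : R -> 'M[R]_(n0, m1);
  B02 : R -> 'M[R]_(n0, m1);
  B10 : R -> 'M[R]_(n1, m0);
  B11 : par1D R n1 m1;
  B12 : R -> R -> 'M[R]_(n1, m1);
  B20 : R -> 'M[R]_(n1, m0);
  B21 : R -> R -> 'M[R]_(n1, m1);
  B22 : par1D R n1 m1 }.

Definition in_N011 (R : realType) n0 m0 n1 m1 (a b c d : R)
    (B : par011 R n0 m0 n1 m1) : Prop :=
  [/\ L2_on a b (B01 B), L2_on c d (B02 B),
      L2_on a b (B10 B) & L2_on c d (B20 B)] /\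
  [/\ L2_on2 a b c d (B12 B), L2_on2 c d a b (B21 B),
      in_N1D a b (B11 B) & in_N1D c d (B22 B)].

Definition eq_N011 (R : realType) n0 m0 n1 m1 (a b c d : R)
    (B B' : par011 R n0 m0 n1 m1) : Prop :=
  let mu := @lebesgue_measure R in
  [/\ B00 B = B00 B',
      ae_eq mu [set` `[a, b]] (B01 B) (B01 B'),
      ae_eq mu [set` `[c, d]] (B02 B) (B02 B'),
      ae_eq mu [set` `[a, b]] (B10 B) (B10 B')
    & ae_eq mu [set` `[c, d]] (B20 B) (B20 B')] /\
  [/\ ae_eq (mu \x mu)%E ([set` `[a, b]] `*` [set` `[c, d]])
        (fun z => B12 B z.1 z.2) (fun z => B12 B' z.1 z.2),
      ae_eq (mu \x mu)%E ([set` `[c, d]] `*` [set` `[a, b]])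
        (fun z => B21 B z.1 z.2) (fun z => B21 B' z.1 z.2),
      eq_N1D a b (B11 B) (B11 B') & eq_N1D c d (B22 B) (B22 B')].

Definition lin011 (R : realType) n0 m0 n1 m1 (k : R)
    (B B' : par011 R n0 m0 n1 m1) : par011 R n0 m0 n1 m1 :=
  Par011 (k *: B00 B + B00 B')
    (fun x => k *: B01 B x + B01 B' x) (fun y => k *: B02 B y + B02 B' y)
    (fun x => k *: B10 B x + B10 B' x) (lin1D k (B11 B) (B11 B'))
    (fun x y => k *: B12 B x y + B12 B' x y)
    (fun y => k *: B20 B y + B20 B' y)
    (fun y x => k *: B21 B y x + B21 B' y x) (lin1D k (B22 B) (B22 B')).

Record state (R : realType) (m0 m1 : nat) := State {
  u0 : 'cV[R]_m0;
  u1 : R -> 'cV[R]_m1;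
  u2 : R -> 'cV[R]_m1 }.

Definition in_RL2 (R : realType) m0 m1 (a b c d : R) (u : state R m0 m1) :
    Prop :=
  L2_on a b (u1 u) /\ L2_on c d (u2 u).

Definition eq_RL2 (R : realType) m0 m1 (a b c d : R) (u v : state R m0 m1) :
    Prop :=
  [/\ u0 u = u0 v,
      ae_eq (@lebesgue_measure R) [set` `[a, b]] (u1 u) (u1 v)
    & ae_eq (@lebesgue_measure R) [set` `[c, d]] (u2 u) (u2 v)].

Definition P011 (R : realType) n0 m0 n1 m1 (a b c d : R)
    (B : par011 R n0 m0 n1 m1) (u : state R m0 m1) : state R n0 n1 :=
  State
    (B00 B *m u0 u + mxint `[a, b] (fun x => B01 B x *m u1 u x)
                   + mxint `[c, d] (fun y => B02 B y *m u2 u y))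
    (fun x => B10 B x *m u0 u + P1D a b (B11 B) (u1 u) x
              + mxint `[c, d] (fun y => B12 B x y *m u2 u y))
    (fun y => B20 B y *m u0 u
              + mxint `[a, b] (fun x => B21 B y x *m u1 u x)
              + P1D c d (B22 B) (u2 u) y).

(* P[B] maps R^m0 x L_2[x] x L_2[y] into R^n0 x L_2[x] x L_2[y].  This is not
   implied by [in_N011]: it forces B_11^0 and B_22^0 to be essentially
   bounded. *)
Definition RL2_operator (R : realType) n0 m0 n1 m1 (a b c d : R)
    (B : par011 R n0 m0 n1 m1) : Prop :=
  forall u : state R m0 m1,
    in_RL2 a b c d u -> in_RL2 a b c d (P011 a b c d B u).

Definition composes (R : realType) n0 m0 n1 m1 p0 p1 (a b c d : R)
    (B : par011 R n0 p0 n1 p1) (D : par011 R p0 m0 p1 m1)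
    (Q : par011 R n0 m0 n1 m1) : Prop :=
  forall u : state R m0 m1, in_RL2 a b c d u ->
    eq_RL2 a b c d (P011 a b c d B (P011 a b c d D u)) (P011 a b c d Q u).

(* A kernel as a function of its integration variable: [Delta s] is the Dirac
   delta located at s. *)
Inductive kernel (R : realType) :=
  | Delta of R
  | Density of R -> R.

Definition kint (R : realType) n m (a b : R) (K : kernel R)
    (F : R -> 'M[R]_(n, m)) : 'M[R]_(n, m) :=
  match K with
  | Delta s => F s
  | Density k => mxint `[a, b] (fun sigma => k sigma *: F sigma)
  end.

Definition kI (R : realType) (s sigma : R) : R := (sigma < s)%R%:R.

Definition kH (R : realType) (s sigma tau : R) : R :=
  ((tau < sigma)%R && (sigma < s)%R)%:R.

(* Phi_i(s, sigma) as a kernel in its second argument sigma... *)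
Definition Phi_snd (R : realType) (i : nat) (s : R) : kernel R :=
  match i with
  | 0 => Delta s
  | 1 => Density (fun sigma => kI s sigma)
  | _ => Density (fun sigma => kI sigma s)
  end.

(* ... and in its first argument s. *)
Definition Phi_fst (R : realType) (i : nat) (sigma : R) : kernel R :=
  match i with
  | 0 => Delta sigma
  | 1 => Density (fun s => kI s sigma)
  | _ => Density (fun s => kI sigma s)
  end.

(* Psi_kij(s, sigma, tau) as a kernel in sigma. *)
Definition Psi (R : realType) (k i j : nat) (s tau : R) : kernel R :=
  match k, i, j with
  | 0, 0, 0 | 1, 0, 1 | 2, 0, 2 => Delta s
  | 1, 1, 0 | 2, 2, 0 => Delta tau
  | 1, 1, 1 => Density (fun sigma => kH s sigma tau)
  | 2, 2, 2 => Density (fun sigma => kH tau sigma s)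
  | 1, 1, 2 => Density (fun sigma => kI tau sigma)
  | 2, 1, 2 => Density (fun sigma => kI s sigma)
  | 1, 2, 1 => Density (fun sigma => kI sigma s)
  | 2, 2, 1 => Density (fun sigma => kI sigma tau)
  | _, _, _ => Density (fun=> 0)
  end.

(* \int_a^b F(eta) (\sum_i Phi_i(eta, theta) N_i(eta, theta)) deta *)
Definition mul_ker (R : realType) n p m (a b : R) (F : R -> 'M[R]_(n, p))
    (N : par1D R p m) (theta : R) : 'M[R]_(n, m) :=
  \sum_(i < 3) kint a b (Phi_fst i theta)
                 (fun eta => F eta *m ker N i eta theta).

(* \int_a^b (\sum_i Phi_i(x, eta) N_i(x, eta)) G(eta) deta *)
Definition ker_mul (R : realType) n p m (a b : R) (N : par1D R n p)
    (G : R -> 'M[R]_(p, m)) (x : R) : 'M[R]_(n, m) :=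
  \sum_(i < 3) kint a b (Phi_snd i x) (fun eta => ker N i x eta *m G eta).

(* \int_a^b (\sum_ij Psi_kij(x, eta, theta) N_i(x, eta) M_j(eta, theta)) deta *)
Definition ker_ker (R : realType) n p m (a b : R) (k : nat) (N : par1D R n p)
    (M : par1D R p m) (x theta : R) : 'M[R]_(n, m) :=
  \sum_(i < 3) \sum_(j < 3)
    kint a b (Psi k i j x theta)
      (fun eta => ker N i x eta *m ker M j eta theta).

Definition eps (R : realType) (k : nat) : R := (k != 0%N)%:R.

Definition R11_formula (R : realType) n0 p0 m0 n1 p1 m1 (a b c d : R)
    (B : par011 R n0 p0 n1 p1) (D : par011 R p0 m0 p1 m1) (k : nat)
    (x theta : R) : 'M[R]_(n1, m1) :=
  ker_ker a b k (B11 B) (B11 D) x theta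
  + eps R k *: (B10 B x *m B01 D theta
                + mxint `[c, d] (fun mu => B12 B x mu *m B21 D mu theta)).

Definition R22_formula (R : realType) n0 p0 m0 n1 p1 m1 (a b c d : R)
    (B : par011 R n0 p0 n1 p1) (D : par011 R p0 m0 p1 m1) (k : nat)
    (y nu : R) : 'M[R]_(n1, m1) :=
  ker_ker c d k (B22 B) (B22 D) y nu
  + eps R k *: (B20 B y *m B02 D nu
                + mxint `[a, b] (fun eta => B21 B y eta *m B12 D eta nu)).

(* For k = 0 the formulas for R_11 and R_22 do not depend on their second
   argument (lemmas [R11_formulaE] and [R22_formulaE] below), so its value is
   immaterial. *)
Definition L011 (R : realType) n0 p0 m0 n1 p1 m1 (a b c d : R)
    (B : par011 R n0 p0 n1 p1) (D : par011 R p0 m0 p1 m1) :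
    par011 R n0 m0 n1 m1 :=
  {| B00 := B00 B *m B00 D
            + mxint `[a, b] (fun eta => B01 B eta *m B10 D eta)
            + mxint `[c, d] (fun mu => B02 B mu *m B20 D mu);
     B01 := fun theta => B00 B *m B01 D theta
            + mul_ker a b (B01 B) (B11 D) theta
            + mxint `[c, d] (fun mu => B02 B mu *m B21 D mu theta);
     B02 := fun nu => B00 B *m B02 D nu
            + mxint `[a, b] (fun eta => B01 B eta *m B12 D eta nu)
            + mul_ker c d (B02 B) (B22 D) nu;
     B10 := fun x => B10 B x *m B00 D
            + ker_mul a b (B11 B) (B10 D) x
            + mxint `[c, d] (fun mu => B12 B x mu *m B20 D mu);
     B11 := Par1D (fun x => R11_formula a b c d B D 0 x x)
                  (R11_formula a b c d B D 1)
                  (R11_formula a b c d B D 2);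
     B12 := fun x nu => B10 B x *m B02 D nu
            + ker_mul a b (B11 B) (fun eta => B12 D eta nu) x
            + mul_ker c d (B12 B x) (B22 D) nu;
     B20 := fun y => B20 B y *m B00 D
            + mxint `[a, b] (fun eta => B21 B y eta *m B10 D eta)
            + ker_mul c d (B22 B) (B20 D) y;
     B21 := fun y theta => B20 B y *m B01 D theta
            + mul_ker a b (B21 B y) (B11 D) theta
            + ker_mul c d (B22 B) (fun mu => B21 D mu theta) y;
     B22 := Par1D (fun y => R22_formula a b c d B D 0 y y)
                  (R22_formula a b c d B D 1)
                  (R22_formula a b c d B D 2) |}.

Lemma ker_ker0E (R : realType) n p m (a b : R) (N : par1D R n p)
    (M : par1D R p m) (x theta : R) :
  ker_ker a b 0 N M x theta = N0 N x *m N0 M x.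
Proof.
have z0 (F : R -> 'M[R]_(n, m)) :
    mxint `[a, b] (fun sigma => 0 *: F sigma) = 0.
  apply/matrixP => i j; rewrite !mxE /Rintegral.
  under eq_integral do rewrite scale0r mxE.
  by rewrite integral0.
rewrite /ker_ker !big_ord_recl !big_ord0 /=.
by rewrite !z0 !addr0.
Qed.

Lemma R11_formulaE (R : realType) n0 p0 m0 n1 p1 m1 (a b c d : R)
    (B : par011 R n0 p0 n1 p1) (D : par011 R p0 m0 p1 m1) (k : 'I_3)
    (x theta : R) :
  ker (B11 (L011 a b c d B D)) k x theta = R11_formula a b c d B D k x theta.
Proof.
case: k => -[|[|[|//]]] //= _.
by rewrite /R11_formula !ker_ker0E /eps eqxx !scale0r.
Qed.

Lemma R22_formulaE (R : realType) n0 p0 m0 n1 p1 m1 (a b c d : R)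
    (B : par011 R n0 p0 n1 p1) (D : par011 R p0 m0 p1 m1) (k : 'I_3)
    (y nu : R) :
  ker (B22 (L011 a b c d B D)) k y nu = R22_formula a b c d B D k y nu.
Proof.
case: k => -[|[|[|//]]] //= _.
by rewrite /R22_formula !ker_ker0E /eps eqxx !scale0r.
Qed.

(* Main.v *)
(* Off the diagonal, a PI operator is an integral operator with a single L2
   kernel, equal to N_1 below the diagonal and to N_2 above it.  Composing
   multiplication operators and integral operators with L2 kernels gives again
   operators of this kind (Cauchy-Schwarz for membership in L2, Fubini for the
   formula), and the kernels Phi_i and Psi_kij only record on which side of the
   diagonal each term lives.

   Uniqueness: if n(x) g(x) + \int K(x, y) g(y) dy = 0 for almost every x, for
   each g in L2, take for g the indicators of countably many half-lines.  For
   almost every fixed x the set function E |-> n(x) 1_E(x) + \int_E K(x, y) dy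
   vanishes on them, hence on all Borel sets; E = {x} gives n(x) = 0, and then
   K(x, .) = 0 almost everywhere. *)
Require Import Defs.
From mathcomp Require Import all_boot all_order all_algebra.
From mathcomp Require Import all_classical all_reals all_analysis.
From mathcomp Require Import measurable_realfun ring lra.
Set Implicit Arguments.
Unset Strict Implicit.
Unset Printing Implicit Defensive.
Import Order.TTheory GRing.Theory Num.Theory.
Import numFieldNormedType.Exports.
Local Open Scope classical_set_scope.
Local Open Scope ring_scope.

(** Integrals are total functions: [fine] sends an infinite value to 0, so additivity, scaling and
    Fubini are available only where the integrands are integrable. An L2 kernel has L2 sections
    along almost every line only. Identities between kernels are therefore proved at points whose
    row and column are L2, whereas L2 membership is proved from expansions that hold at every point.
    The diagonal multiplications are the obstacle to a pure Hilbert-Schmidt argument: an L2 function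
    times an L2 kernel need not be L2. The operator hypothesis repairs this: testing it on
    [(0, g e_j, 0)] and subtracting the integral part, which is L2 anyway, leaves [g] times a column
    of the diagonal parameter. In the uniqueness argument the exceptional null set depends on the
    test function. Testing the indicator of [{x}] directly would say nothing, since the identity may
    fail exactly at [x]. A countable family has a common null set, and Dynkin's lemma then reaches
    [{x}] with [x] already fixed. *)

(** * Almost everywhere statements *)

Section almost_everywhere_implications.
Context d (T : measurableType d) (R : realType).
Variable mu : {measure set T -> \bar R}.
Implicit Types P Q S U : T -> Prop.

Lemma ae_imply P Q : (forall x, P x -> Q x) ->
  {ae mu, forall x, P x} -> {ae mu, forall x, Q x}.
Proof. by move=> PQ; apply: filterS. Qed.

Lemma ae_imply2 P Q S : (forall x, P x -> Q x -> S x) ->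
  {ae mu, forall x, P x} -> {ae mu, forall x, Q x} -> {ae mu, forall x, S x}.
Proof. by move=> PQS; apply: filterS2. Qed.

Lemma ae_imply3 P Q S U : (forall x, P x -> Q x -> S x -> U x) ->
  {ae mu, forall x, P x} -> {ae mu, forall x, Q x} ->
  {ae mu, forall x, S x} -> {ae mu, forall x, U x}.
Proof. by move=> PQSU; apply: filterS3. Qed.

Lemma ae_forall_fin (I : finType) (P : I -> T -> Prop) :
  (forall i, {ae mu, forall x, P i x}) -> {ae mu, forall x, forall i, P i x}.
Proof.
(* Indexing by ranks reduces the finite intersection to the countable one of [ae_foralln]. *)
move=> aeP; have : {ae mu, forall x, forall (k : nat) i,
    k = enum_rank i -> P i x}.
  apply/ae_foralln => k; have [kn|kn] := ltnP k #|I|; last first.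
    by apply: aeW => x i ke; move: kn; rewrite ke leqNgt ltn_ord.
  apply: ae_imply (aeP (enum_val (Ordinal kn))) => x Px i ke.
  have E : Ordinal kn = enum_rank i by exact: val_inj.
  by move: Px; rewrite E enum_rankK.
by apply: ae_imply => x Px i; exact: Px.
Qed.

End almost_everywhere_implications.

(** * Square-integrable functions on a measure space *)

Section square_integrable.
Context d (T : measurableType d) (R : realType).
Variable mu : {measure set T -> \bar R}.

(** Trades the L2 norm, built from powers with real exponents, for an integral of squares, to which
    comparison and Tonelli apply directly. *)
Lemma Lfun2P (f : T -> R) : f \in Lfun mu 2%:E <->
  measurable_fun setT f /\ (\int[mu]_x (f x ^+ 2)%:E < +oo)%E.
Proof.
split=> [L2f|[mf oof]].
  split.
    by have := sub_Lfun_mfun L2f; rewrite inE.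
  have /integrableP[_] := Lfun2_integrable_sqr L2f.
  by under eq_integral do rewrite /= ger0_norm ?sqr_ge0//.
rewrite inE; apply/andP; split; rewrite inE//= /finite_norm unlock.
apply: poweR_lty; apply: le_lt_trans oof.
under eq_integral do
  rewrite /= powR_mulrn ?normr_ge0// -normrX ger0_norm ?sqr_ge0//.
exact: lexx.
Qed.

Lemma Lfun2_measurable (f : T -> R) :
  f \in Lfun mu 2%:E -> measurable_fun setT f.
Proof. by case/Lfun2P. Qed.

Lemma Lfun2_integrableM (f g : T -> R) :
  f \in Lfun mu 2%:E -> g \in Lfun mu 2%:E ->
  mu.-integrable setT (fun x => (f x * g x)%:E).
Proof. by move=> f2 g2; apply/Lfun1_integrable/Lfun2_mul_Lfun1. Qed.

Lemma Lfun2_le (f g : T -> R) : measurable_fun setT f ->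
  g \in Lfun mu 2%:E -> (forall x, `|f x| <= `|g x|) -> f \in Lfun mu 2%:E.
Proof.
move=> mf /Lfun2P[mg goo] fg; apply/Lfun2P; split => //.
apply: le_lt_trans goo; apply: ge0_le_integral => //.
- by move=> x _; rewrite lee_fin sqr_ge0.
- by apply/measurable_EFinP; exact: measurable_funX.
- by apply/measurable_EFinP; exact: measurable_funX.
- move=> x _; rewrite lee_fin -(real_normK (num_real (f x))).
  rewrite -(real_normK (num_real (g x))).
  by rewrite ler_sqr ?nnegrE ?normr_ge0.
Qed.

Lemma Lfun2_scale  k (f : T -> R) :
  f \in Lfun mu 2%:E -> (fun x => k * f x) \in Lfun mu 2%:E.
Proof.
move=> f2; have := @Lfun_scale _ _ _ mu f k 2 _ f2.
rewrite (_ : k \o* f = fun x => k * f x); last first.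
  by apply/funext => x /=; rewrite mulrC.
by apply; rewrite ler1n.
Qed.

Lemma Lfun2_add (f g : T -> R) : f \in Lfun mu 2%:E -> g \in Lfun mu 2%:E ->
  (fun x => f x + g x) \in Lfun mu 2%:E.
Proof. 
have [_] := Lfun_addr_closed mu (lee1n 2 : (1 <= 2%:R%:E :> \bar R)%E).
exact.
Qed.

(** The weights are indicators such as [chi], [kI] and [kH]. *)
Lemma Lfun2_weight (w f : T -> R) :
  measurable_fun setT w -> (forall x, `|w x| <= 1) ->
  f \in Lfun mu 2%:E -> (fun x => w x * f x) \in Lfun mu 2%:E.
Proof.
move=> mw w1 f2; apply: (Lfun2_le _ f2) => [|x].
  by apply: measurable_funM => //; exact: Lfun2_measurable f2.
by rewrite normrM -[leRHS]mul1r ler_wpM2r.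
Qed.

Lemma Lfun2_sum (I : finType) (f : I -> T -> R) :
  (forall i, f i \in Lfun mu 2%:E) ->
  (fun x => \sum_i f i x) \in Lfun mu 2%:E.
Proof.
move=> f2.
rewrite (_ : (fun x => _) = \sum_i f i); last first.
  by apply/funext => x; rewrite fct_sumE.
have [L0 LD] := Lfun_addr_closed mu (lee1n 2 : (1 <= 2%:R%:E :> \bar R)%E).
by elim/big_ind : (\sum_i _).
Qed.

Lemma Lfun2_norm (f : T -> R) :
  f \in Lfun mu 2%:E -> (fun x => `|f x|) \in Lfun mu 2%:E.
Proof.
move=> f2; apply: (Lfun2_le _ f2) => [|x]; last by rewrite normr_id.
by apply: measurableT_comp => //; exact: Lfun2_measurable f2.
Qed.

(** Hoelder's inequality with both exponents 2, squared. The values are extended reals and nothing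
    is assumed finite, so that it applies to every section of a kernel, the exceptional ones
    included. *)
Lemma cauchy_schwarz_integral (f g : T -> R) :
  measurable_fun setT f -> measurable_fun setT g ->
  ((\int[mu]_x `|f x * g x|%:E) ^+ 2 <=
   (\int[mu]_x (f x ^+ 2)%:E) * (\int[mu]_x (g x ^+ 2)%:E))%E.
Proof.
move=> mf mg.
have N2 (h : T -> R) : ('N[mu]_2%:E[EFin \o h] ^+ 2 =
    \int[mu]_x (h x ^+ 2)%:E)%E.
  rewrite unlock poweR12_sqrt ?sqr_sqrte; last 2 first.
  - by apply: integral_ge0 => x _; exact: poweR_ge0.
  - by apply: integral_ge0 => x _; exact: poweR_ge0.
  apply: eq_integral => x _ /=.
  by rewrite powR_mulrn ?normr_ge0// -normrX ger0_norm ?sqr_ge0.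
have /= := @hoelder _ _ _ mu f g 2 2 mf mg.
rewrite Lnorm1 => /(_ _ _ _)/= H.
rewrite -(N2 f) -(N2 g) !expe2 muleACA.
apply: lee_pmul; rewrite ?integral_ge0//; apply: H => //;
 by rewrite [RHS]splitr !div1r.
Qed.

End square_integrable.

(** * Square-integrable kernels on product spaces *)

Lemma measurable_Rintegral d1 d2 (X : measurableType d1) (Y : measurableType d2)
    (R : realType) (mY : {sigma_finite_measure set Y -> \bar R})
    (f : X * Y -> R) : measurable_fun setT f ->
  measurable_fun setT (fun x => \int[mY]_y f (x, y)).
Proof.
move=> mf; apply: measurableT_comp; first exact: fine_measurable.
have mF : measurable_fun setT (EFin \o f) by exact/measurable_EFinP.
(* Tonelli gives measurability of the integrals of the positive and negative parts. Their difference
   is measurable even where a section is not integrable. *)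
rewrite (_ : (fun x => _) =
    fubini_F mY (EFin \o f)^\+%E \- fubini_F mY (EFin \o f)^\-%E)%E; last first.
  apply/funext => x; rewrite [LHS]integralE.
  congr (_ - _)%E; apply: eq_integral => y _.
    by rewrite !unlock.
  by rewrite !unlock.
apply: emeasurable_funB; apply: measurable_fun_fubini_tonelli_F => //.
- exact: measurable_funepos.
- exact: measurable_funeneg.
Qed.

Section product_square_integrable.
Context d1 d2 (X : measurableType d1) (Y : measurableType d2) (R : realType).
Variable mX : {sigma_finite_measure set X -> \bar R}.
Variable mY : {sigma_finite_measure set Y -> \bar R}.

Lemma Lfun2_prodP (F : X * Y -> R) : F \in Lfun (mX \x mY)%E 2%:E <->
  measurable_fun setT F /\
  (\int[mX]_x \int[mY]_y (F (x, y) ^+ 2)%:E < +oo)%E.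
Proof.
apply: (iff_trans (Lfun2P _ _)); split=> -[mF Foo]; split=> //; move: Foo.
all: rewrite (fubini_tonelli1 (fun z => (F z ^+ 2)%:E))//.
all: by [apply/measurable_EFinP; exact: measurable_funX
        |move=> z; rewrite lee_fin sqr_ge0].
Qed.

Lemma Lfun2_swap (F : X * Y -> R) : F \in Lfun (mX \x mY)%E 2%:E ->
  (fun z => F (z.2, z.1)) \in Lfun (mY \x mX)%E 2%:E.
Proof.
move=> /Lfun2P[mF Foo]; apply/Lfun2P; split.
  by apply: measurableT_comp => //; exact: measurable_swap.
rewrite (fubini_tonelli1 (fun z => (F (z.2, z.1) ^+ 2)%:E))/=.
- move: Foo; rewrite (fubini_tonelli2 (fun z => (F z ^+ 2)%:E))//.
  + by apply/measurable_EFinP; exact: measurable_funX.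
  + by move=> z; rewrite lee_fin sqr_ge0.
- apply/measurable_EFinP; apply: measurable_funX.
  by apply: measurableT_comp => //; exact: measurable_swap.
- by move=> z; rewrite lee_fin sqr_ge0.
Qed.

(** Fubini for the integrable function [F ^+ 2]. *)
Lemma Lfun2_section (F : X * Y -> R) : F \in Lfun (mX \x mY)%E 2%:E ->
  {ae mX, forall x, (fun y => F (x, y)) \in Lfun mY 2%:E}.
Proof.
move=> F2; have := ae_integrable1 (Lfun2_integrable_sqr F2).
apply: filterS => x /integrableP[_ Fx]; apply/Lfun2P; split.
  by apply: measurableT_comp => //; exact: Lfun2_measurable F2.
apply: le_lt_trans Fx; rewrite le_eqVlt; apply/orP; left; apply/eqP.
apply: eq_integral => y _ /=.
by rewrite ger0_norm ?sqr_ge0.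
Qed.

Lemma Lfun2_tensor (f : X -> R) (g : Y -> R) :
  f \in Lfun mX 2%:E -> g \in Lfun mY 2%:E ->
  (fun z => f z.1 * g z.2) \in Lfun (mX \x mY)%E 2%:E.
Proof.
move=> /Lfun2P[mf foo] /Lfun2P[mg goo]; apply/Lfun2_prodP; split.
  by apply: measurable_funM; exact: measurableT_comp.
have f2ge0 : (0 <= \int[mX]_x (f x ^+ 2)%:E)%E.
  by apply: integral_ge0 => x _; rewrite lee_fin sqr_ge0.
have mf2 : measurable_fun setT (fun x => (f x ^+ 2)%:E).
  by apply/measurable_EFinP; exact: measurable_funX.
have mg2 : measurable_fun setT (fun x => (g x ^+ 2)%:E).
  by apply/measurable_EFinP; exact: measurable_funX.
under eq_integral => x _.
  under eq_integral do rewrite exprMn EFinM /=.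
  rewrite ge0_integralZl//; last 2 first.
    by move=> y _; rewrite lee_fin sqr_ge0.
    by rewrite lee_fin sqr_ge0.
  over.
rewrite ge0_integralZr//.
- by rewrite lte_mul_pinfty// ge0_fin_numE.
- by move=> y _; rewrite lee_fin sqr_ge0.
- by apply: integral_ge0 => y _; rewrite lee_fin sqr_ge0.
Qed.

Lemma Lfun2_mul_section (N : X -> R) (G : X * Y -> R) :
  measurable_fun setT N ->
  (forall h, h \in Lfun mX 2%:E -> (fun x => N x * h x) \in Lfun mX 2%:E) ->
  G \in Lfun (mX \x mY)%E 2%:E ->
  (fun z => N z.1 * G z) \in Lfun (mX \x mY)%E 2%:E.
Proof.
move=> mN multN /[dup] G2 /Lfun2_prodP[mG Goo].
have mG2 : measurable_fun setT (fun z => (G z ^+ 2)%:E).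
  by apply/measurable_EFinP; exact: measurable_funX.
have G2ge0 z : (0 <= (G z ^+ 2)%:E :> \bar R)%E by rewrite lee_fin sqr_ge0.
(* [h] collects the L2 norms of the sections of [G]: it is in L2, and
   multiplying [G] by [N] multiplies [h] by [`|N|]. *)
pose H x := (\int[mY]_y (G (x, y) ^+ 2)%:E)%E.
have H0 x : (0 <= H x)%E by exact: integral_ge0.
have mH : measurable_fun setT H.
  exact: (measurable_fun_fubini_tonelli_F (fun z => (G z ^+ 2)%:E)).
pose h x := Num.sqrt (fine (H x)).
have hE x : h x ^+ 2 = fine (H x) by rewrite sqr_sqrtr// fine_ge0.
(* [h x ^+ 2] is [fine (H x)], which gives back [H x] only where the latter is finite. *)
have Hfin : {ae mX, forall x, H x \is a fin_num}.
  have : mX.-integrable setT H.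
    apply/integrableP; split => //.
    by under eq_integral do rewrite gee0_abs//.
  by move/(integrable_ae measurableT); apply: filterS => x; exact.
have h2 : h \in Lfun mX 2%:E.
  apply/Lfun2P; split.
    apply: (measurableT_comp (continuous_measurable_fun (@sqrt_continuous R))).
    by apply: measurableT_comp => //; exact: fine_measurable.
  under eq_integral do rewrite hE.
  apply: le_lt_trans Goo; apply: ge0_le_integral => //.
  - by move=> x _; rewrite lee_fin fine_ge0.
  - apply/measurable_EFinP.
    by apply: measurableT_comp => //; exact: fine_measurable.
  - move=> x _; rewrite -/(H x).
    by move: (H0 x); case: (H x) => //= r _; rewrite leey.
apply/Lfun2_prodP; split.
  by apply: measurable_funM => //; exact: measurableT_comp.
have /Lfun2P[mNh] := multN _ h2; apply: le_lt_trans.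
under [leLHS]eq_integral => x _.
  under eq_integral do rewrite exprMn EFinM /=.
  rewrite ge0_integralZl//; last 2 first.
    exact: (measurableT_comp mG2).
    by rewrite lee_fin sqr_ge0.
  rewrite -/(H x); over.
rewrite le_eqVlt; apply/orP; left; apply/eqP.
apply: ge0_ae_eq_integral => //.
- apply: emeasurable_funM => //.
  by apply/measurable_EFinP; exact: measurable_funX.
- by apply/measurable_EFinP; exact: measurable_funX.
- by move=> x _; rewrite mule_ge0// lee_fin sqr_ge0.
- by move=> x _; rewrite lee_fin sqr_ge0.
by apply: filterS Hfin => x Hx _; rewrite exprMn hE [RHS]EFinM fineK.
Qed.

(** By Tonelli the integral of [|K|] is an iterated integral whose inner one vanishes almost
    everywhere. *)
Lemma ae_eq0_of_sections (K : X * Y -> R) : measurable_fun setT K ->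
  {ae mX, forall x, {ae mY, forall y, K (x, y) = 0}} ->
  {ae (mX \x mY)%E, forall z, K z = 0}.
Proof.
move=> mK K0; have mKE : measurable_fun setT (fun z => (K z)%:E).
  exact/measurable_EFinP.
have : ae_eq (mX \x mY)%E setT (fun z => (K z)%:E) (cst 0%E).
  have [+ _] := ae_eq_integral_abs (mX \x mY)%E measurableT mKE; apply.
  rewrite (fubini_tonelli1 (fun z => `|(K z)%:E|%E))//; last first.
    exact: measurableT_comp.
  rewrite (ge0_ae_eq_integral (g := cst 0%E))//.
  - by rewrite integral0.
  - apply: (measurable_fun_fubini_tonelli_F (fun z => `|(K z)%:E|%E)) => //.
    exact: measurableT_comp.
  - by move=> x _; exact: integral_ge0.
  apply: ae_imply K0 => x Kx _; rewrite /fubini_F.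
  have mKx : measurable_fun setT (fun y => (K (x, y))%:E).
    exact: (measurableT_comp mKE).
  have [_] := ae_eq_integral_abs mY measurableT mKx.
  by apply; apply: ae_imply Kx => y -> _.
by apply: ae_imply => z /(_ I) [].
Qed.

Lemma ae_prod1 (P : X -> Prop) : {ae mX, forall x, P x} ->
  {ae (mX \x mY)%E, forall z, P z.1}.
Proof.
move=> [N [mN N0 PN]]; exists (N `*` setT); split.
- exact: measurableX.
- have -> : (mX \x mY)%E (N `*` setT) = (mX N * mY setT)%E.
    exact: product_measure1E.
  by rewrite N0 mul0e.
- by move=> z /= nPz; split => //; exact: PN.
Qed.

Lemma ae_prod2 (P : Y -> Prop) : {ae mY, forall y, P y} ->
  {ae (mX \x mY)%E, forall z, P z.2}.
Proof.
move=> [N [mN N0 PN]]; exists (setT `*` N); split.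
- exact: measurableX.
- have -> : (mX \x mY)%E (setT `*` N) = (mX setT * mY N)%E.
    exact: product_measure1E.
  by rewrite N0 mule0.
- by move=> z /= nPz; split => //; exact: PN.
Qed.

End product_square_integrable.

(** The Hilbert-Schmidt estimate: by Cauchy-Schwarz in [y], the square of the composed kernel at
    [(x, z)] is at most [HF x * HG z], whose double integral factors. Asking only that [f] be
    dominated by the product leaves room for indicator weights depending on all three variables. *)
Lemma Lfun2_kernel_comp d1 d2 d3 (X : measurableType d1)
    (Y : measurableType d2) (Z : measurableType d3) (R : realType)
    (mX : {sigma_finite_measure set X -> \bar R})
    (mY : {sigma_finite_measure set Y -> \bar R})
    (mZ : {sigma_finite_measure set Z -> \bar R})
    (F : X * Y -> R) (G : Y * Z -> R) (f : (X * Z) * Y -> R) :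
  F \in Lfun (mX \x mY)%E 2%:E -> G \in Lfun (mY \x mZ)%E 2%:E ->
  measurable_fun setT f ->
  (forall x y z, `|f (x, z, y)| <= `|F (x, y) * G (y, z)|) ->
  (fun xz => \int[mY]_y f (xz, y)) \in Lfun (mX \x mZ)%E 2%:E.
Proof.
move=> /[dup] F2 /Lfun2_prodP[mF Foo] G2 mf fFG.
have /Lfun2_prodP[mG Goo] := Lfun2_swap G2.
apply/Lfun2_prodP; split; first exact: measurable_Rintegral.
have F2ge0 z : (0 <= (F z ^+ 2)%:E :> \bar R)%E by rewrite lee_fin sqr_ge0.
have G2ge0 z : (0 <= (G z ^+ 2)%:E :> \bar R)%E by rewrite lee_fin sqr_ge0.
have mF2 : measurable_fun setT (fun z => (F z ^+ 2)%:E).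
  by apply/measurable_EFinP; exact: measurable_funX.
have mG2 : measurable_fun setT (fun z => (G z ^+ 2)%:E).
  by apply/measurable_EFinP; apply: measurable_funX; exact: Lfun2_measurable G2.
pose HF x := (\int[mY]_y (F (x, y) ^+ 2)%:E)%E.
pose HG z := (\int[mY]_y (G (y, z) ^+ 2)%:E)%E.
have HF0 x : (0 <= HF x)%E by exact: integral_ge0.
have HG0 z : (0 <= HG z)%E by exact: integral_ge0.
have mHF : measurable_fun setT HF.
  exact: (measurable_fun_fubini_tonelli_F (fun z => (F z ^+ 2)%:E)).
have mHG : measurable_fun setT HG.
  exact: (measurable_fun_fubini_tonelli_G (fun z => (G z ^+ 2)%:E)).
have le_H x z : (((\int[mY]_y f (x, z, y)) ^+ 2)%:E <= HF x * HG z)%E.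
  apply: le_trans (cauchy_schwarz_integral _ _ _); last 2 first.
  - exact: measurableT_comp.
  - by apply: measurableT_comp => //; exact: Lfun2_measurable G2.
  rewrite -(real_normK (num_real (\int[mY]_y _))) EFin_expe lee_sqr//; last first.
    exact: integral_ge0.
  apply: (@le_trans _ _ (`|\int[mY]_y (f (x, z, y))%:E|)%E).
    (* If the integral is infinite, [fine] returns 0 and the bound is trivial. *)
    rewrite /Rintegral; case: (\int[mY]_y _)%E => [r| |] //=.
    - by rewrite normr0 leey.
    - by rewrite normr0 leey.
  apply: le_trans (le_abse_integral _ _ _) _ => //.
    by apply/measurable_EFinP; exact: measurableT_comp.
  apply: ge0_le_integral => //.
  - do 2 apply: measurableT_comp => //; exact: measurableT_comp.
  - apply/measurable_EFinP; apply: measurableT_comp => //.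
    apply: measurable_funM; apply: measurableT_comp => //.
    exact: Lfun2_measurable G2.
  - by move=> y _; rewrite lee_fin; exact: fFG.
apply: (@le_lt_trans _ _ (\int[mX]_x \int[mZ]_z (HF x * HG z))%E).
  have mf2 : measurable_fun setT
      (fun xz : X * Z => ((\int[mY]_y f (xz, y)) ^+ 2)%:E).
    apply/measurable_EFinP; apply: measurable_funX.
    exact: measurable_Rintegral.
  apply: ge0_le_integral => //.
  - by move=> x _; apply: integral_ge0 => z _; rewrite lee_fin sqr_ge0.
  - apply: (measurable_fun_fubini_tonelli_F
      (fun xz : X * Z => ((\int[mY]_y f (xz, y)) ^+ 2)%:E)) => //.
    by move=> z; rewrite lee_fin sqr_ge0.
  - apply: (measurable_fun_fubini_tonelli_F (fun xz => HF xz.1 * HG xz.2)%E).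
    - by apply: emeasurable_funM; exact: measurableT_comp.
    - by move=> z; exact: mule_ge0.
  - move=> x _; apply: ge0_le_integral => //.
    + by move=> z _; rewrite lee_fin sqr_ge0.
    + exact: (measurableT_comp mf2).
    + by apply: emeasurable_funM => //; exact: measurable_cst.
under eq_integral do rewrite ge0_integralZl//.
rewrite ge0_integralZr//; last exact: integral_ge0.
by rewrite lte_mul_pinfty// ?ge0_fin_numE//; exact: integral_ge0.
Qed.

(** The sum is the one in an entry of a matrix product. It stays inside the integral, because the
    integral cannot be split at points where the sections are not integrable; instead the whole sum
    is dominated by the product of [\sum_k |F k|] and [\sum_k |G k|], both in L2. *)
Lemma Lfun2_kernel_comp_sum d1 d2 d3 (X : measurableType d1)
    (Y : measurableType d2) (Z : measurableType d3) (R : realType)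
    (mX : {sigma_finite_measure set X -> \bar R})
    (mY : {sigma_finite_measure set Y -> \bar R})
    (mZ : {sigma_finite_measure set Z -> \bar R}) (I : finType)
    (F : I -> X * Y -> R) (G : I -> Y * Z -> R) (w : (X * Z) * Y -> R) :
  (forall k, F k \in Lfun (mX \x mY)%E 2%:E) ->
  (forall k, G k \in Lfun (mY \x mZ)%E 2%:E) ->
  measurable_fun setT w -> (forall t, `|w t| <= 1) ->
  (fun xz => \int[mY]_y
     (w (xz, y) * \sum_k F k (xz.1, y) * G k (y, xz.2)))
    \in Lfun (mX \x mZ)%E 2%:E.
Proof.
move=> F2 G2 mw w1.
have sF := Lfun2_sum (fun k => Lfun2_norm (F2 k)).
have sG := Lfun2_sum (fun k => Lfun2_norm (G2 k)).
apply: (Lfun2_kernel_comp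
  (f := fun t => w t * \sum_k F k (t.1.1, t.2) * G k (t.2, t.1.2)) sF sG).
  apply: measurable_funM => //; apply: measurable_sum => k.
  apply: measurable_funM.
  - apply: (measurableT_comp (Lfun2_measurable (F2 k))).
    apply: measurable_fun_pair => //.
    exact: (measurableT_comp measurable_fst measurable_fst).
  - apply: (measurableT_comp (Lfun2_measurable (G2 k))).
    apply: measurable_fun_pair => //.
    exact: (measurableT_comp measurable_snd measurable_fst).
move=> x y z /=; rewrite normrM -[leRHS]mul1r ler_pM//.
rewrite (le_trans (ler_norm_sum _ _ _))//.
rewrite [leRHS]ger0_norm; last first.
  by rewrite mulr_ge0// sumr_ge0.
rewrite mulr_suml ler_sum// => k _; rewrite normrM ler_wpM2l//.
by rewrite (bigD1 k)//= lerDl sumr_ge0.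
Qed.

Lemma ae_eq_Rintegral d (T : measurableType d) (R : realType)
    (mu : {measure set T -> \bar R}) (f g : T -> R) :
  measurable_fun setT f -> measurable_fun setT g ->
  {ae mu, forall x, f x = g x} -> \int[mu]_x f x = \int[mu]_x g x.
Proof.
move=> mf mg fg; congr fine; apply: ae_eq_integral => //.
- exact/measurable_EFinP.
- exact/measurable_EFinP.
- by apply: ae_imply fg => x ->.
Qed.

(** The real inner integrals agree with the extended ones where the section is integrable, that is
    almost everywhere, and the outer integral sees no more. *)
Lemma Rintegral_Fubini d1 d2 (Y : measurableType d1) (Z : measurableType d2)
    (R : realType) (mY : {sigma_finite_measure set Y -> \bar R})
    (mZ : {sigma_finite_measure set Z -> \bar R}) (H : Y * Z -> R) :
  (mY \x mZ)%E.-integrable setT (EFin \o H) ->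
  \int[mY]_y \int[mZ]_z H (y, z) = \int[mZ]_z \int[mY]_y H (y, z).
Proof.
move=> intH; have mH : measurable_fun setT H.
  by apply/measurable_EFinP; exact: measurable_int intH.
rewrite /Rintegral; congr fine.
transitivity (\int[mY]_y \int[mZ]_z (H (y, z))%:E)%E.
  apply: ae_eq_integral => //.
  - by apply/measurable_EFinP; exact: (@measurable_Rintegral _ _ _ _ _ mZ H).
  - exact: (measurable_fubini_F intH).
  apply: ae_imply (ae_integrable1 intH) => y iH _.
  by rewrite fineK//; exact: integrable_fin_num.
rewrite (Fubini intH); apply/esym; apply: ae_eq_integral => //.
- apply/measurable_EFinP.
  apply: (@measurable_Rintegral _ _ _ _ _ mY (fun z => H (z.2, z.1))).
  by apply: measurableT_comp => //; exact: measurable_swap.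
- exact: (measurable_fubini_G intH).
apply: ae_imply (ae_integrable2 intH) => z iH _.
by rewrite fineK//; exact: integrable_fin_num.
Qed.

(** * Vanishing criteria *)

(** A countable pi-system generating the Borel sets: the intersection of two such rays is one of
    them. *)
Definition rational_rays (R : realType) : set (set R) :=
  range (fun q : rat => `[ratr q, +oo[%classic).

Lemma setI_closed_rational_rays (R : realType) :
  setI_closed (@rational_rays R).
Proof.
move=> _ _ [p _ <-] [q _ <-]; wlog pq : p q / p <= q => [H|].
  by have [/H//|/ltW /H] := leP p q; rewrite setIC.
exists q => //; apply/seteqP; split=> y /=; rewrite !in_itv/= !andbT.
  by move=> qy; split=> //; rewrite (le_trans _ qy)// ler_rat.
by case.
Qed.

Lemma measurable_rational_rays (R : realType) :
  @measurable _ R = <<s @rational_rays R >>.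
Proof.
apply/seteqP; split=> [E|E]; last first.
  apply: smallest_sub; first exact: sigma_algebra_measurable.
  by move=> _ [q _ <-]; exact: measurable_itv.
have [+ _] := (seteqP _ _).1 (RGenOInfty.measurableE R).
move=> /(_ E) H /H; move: E {H}.
have [s0 _ sU] := smallest_sigma_algebra [set: R] (@rational_rays R).
apply: smallest_sub; first exact: smallest_sigma_algebra.
move=> _ [r ->].
(* []r, +oo[] is the union of the closed rays starting at rationals [q > r]. Codes of no rational,
   or of a rational at most [r], contribute the empty set. *)
pose F (n : nat) : set R := if unpickle n is Some q then
  if r < ratr q then `[ratr (q : rat) : R, +oo[%classic else set0 else set0.
rewrite (_ : `]r, +oo[%classic = \bigcup_n F n).
  apply: sU => n; rewrite /F; case: unpickle => // q; case: ifPn => // _.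
  by apply: sub_gen_smallest; exists q.
apply/seteqP; split=> y /=; rewrite in_itv/= andbT.
  move=> /rat_in_itvoo[q]; rewrite in_itv/= => /andP[rq qy].
  exists (pickle q); first exact: I.
  by rewrite /F pickleK rq set_itvE /= ltW.
move=> [n _]; rewrite /F; case: unpickle => // q; case: ifPn => // rq.
by rewrite /= in_itv/= andbT; exact: lt_le_trans.
Qed.

(* Only countably many [E] are tested, so that the lemma applies to almost
   every [x] when [n0] and [k] depend on [x]. *)
Lemma eq0_of_rational_rays (R : realType) (x n0 : R) (k : R -> R) :
  (@lebesgue_measure R).-integrable setT (EFin \o k) ->
  n0 + \int[@lebesgue_measure R]_y k y = 0 ->
  (forall E, rational_rays E ->
    n0 * \1_E x + \int[@lebesgue_measure R]_(y in E) k y = 0) ->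
  n0 = 0 /\ {ae @lebesgue_measure R, forall y, k y = 0}.
Proof.
move=> ik k0T k0G; set mu := @lebesgue_measure R.
have ikE E : measurable E -> mu.-integrable E (EFin \o k).
  by move=> mE; apply: integrableS ik.
have finE E : measurable E -> (\int[mu]_(y in E) (k y)%:E)%E \is a fin_num.
  by move=> mE; apply: (integrable_fin_num mE); exact: ikE.
have k0 E : measurable E -> n0 * \1_E x + \int[mu]_(y in E) k y = 0.
  rewrite measurable_rational_rays; move: E.
  apply: dynkin_induction.
  - exact: measurable_rational_rays.
  - exact: setI_closed_rational_rays.
  - by rewrite indicT mulr1.
  - exact: k0G.
  - move=> E mE kE.
    (* Subtract the identity for [E] from the one for the whole line; the latter is not a ray, which
       is why it is a separate hypothesis. *)
    have := k0T; rewrite -(setUv E) Rintegral_setU//; last 3 first.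
    + exact: measurableC.
    + by rewrite setUv.
    + by apply/disj_setPS => y [].
    have -> : \1_(~` E) x = 1 - \1_E x :> R.
      by rewrite !indicE in_setC; case: (x \in E); rewrite /= ?subrr ?subr0.
    by rewrite mulrBr mulr1; lra.
  - move=> F mF tF kF.
    have int0 (G : (set R)^nat) : (forall n, measurable (G n)) ->
        trivIset setT G -> (forall n, \int[mu]_(y in G n) k y = 0) ->
        \int[mu]_(y in \bigcup_n G n) k y = 0.
      move=> mG tG G0; rewrite /Rintegral integral_bigcup//; last first.
        exact: (ikE _ (bigcupT_measurable _ mG)).
      rewrite eseries0// => n _ _.
      have := congr1 EFin (G0 n); rewrite /Rintegral fineK//.
      exact: (finE _ (mG n)).
    (* By disjointness [x] lies in at most one [F m]. The indicator term vanishes for all the other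
       sets, so their integrals are 0 and the identity for the union is the one for [F m]. *)
    have [[m _ Fmx]|nFx] := pselect ((\bigcup_n F n) x); last first.
      rewrite indicE memNset// mulr0 add0r; apply: int0 => // n.
      have := kF n; rewrite indicE memNset ?mulr0 ?add0r//.
      by move=> Fnx; apply: nFx; exists n.
    rewrite indicE mem_set; last by exists m.
    rewrite mulr1 (@bigcup_setD1 _ _ m)//.
    pose G n := if n == m then set0 else F n.
    have GE : \bigcup_(n in setT `\ m) F n = \bigcup_n G n.
      apply/seteqP; split=> y [n]; rewrite /G.
        by move=> [_ /eqP nm] Fny; exists n => //; rewrite (negbTE nm).
      by case: eqP => // nm _ Fny; exists n.
    have mG n : measurable (G n).
      by rewrite /G; case: ifP => _; [exact: measurable0|exact: mF].
    have tG : trivIset setT G.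
      move=> i j _ _; rewrite /G; case: eqP => [_ [y []]//|_].
      by case: eqP => [_ [y []]//|_]; exact: tF.
    rewrite GE Rintegral_setU; last 4 first.
    - exact: mF.
    - exact: (bigcupT_measurable _ mG).
    - by apply: ikE; exact: (measurableU _ _ (mF m) (bigcupT_measurable _ mG)).
    - apply/disj_setPS => y [Fmy [n _]]; rewrite /G; case: eqP => // nm Fny.
      by apply: nm; apply: (tF n m) => //; exists y.
    rewrite (int0 _ mG tG) ?addr0.
      have := kF m; rewrite indicE mem_set//= mulr1.
      by [].
    move=> n; rewrite /G; case: eqP => [_|nm]; first by rewrite Rintegral_set0.
    have := kF n; rewrite indicE memNset ?mulr0 ?add0r//.
    by move=> Fnx; apply: nm; apply: (tF n m) => //; exists x.
have n00 : n0 = 0.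
  have := k0 [set x] (measurable_set1 _).
  by rewrite Rintegral_set1 addr0 indicE mem_set//= mulr1.
split=> //; rewrite n00 in k0.
have : ae_eq mu setT (EFin \o k) (cst 0%E).
  apply: integral_ae_eq => // E _ mE; rewrite integral0.
  have := k0 E mE; rewrite mul0r add0r => k0E.
  have := congr1 EFin k0E; rewrite /Rintegral fineK//.
  exact: finE.
by apply: filterS => y /(_ I) [].
Qed.

(** Passes from one null set per ray to one null set for all rays, applies the pointwise criterion
    to each remaining section, and glues the sections by Tonelli. [A] is the interval on which the
    identities are known; outside it the kernel has been cut off. *)
Lemma eq0_of_section_integrals (R : realType) (A : set R) (n : R -> R)
    (K : R * R -> R) :
  K \in Lfun (@lebesgue_measure R \x @lebesgue_measure R)%E 2%:E ->
  {ae @lebesgue_measure R, forall x,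
    (@lebesgue_measure R).-integrable setT (fun y => (K (x, y))%:E)} ->
  {ae @lebesgue_measure R, forall x, A x ->
    n x + \int[@lebesgue_measure R]_y K (x, y) = 0} ->
  (forall E, rational_rays E -> {ae @lebesgue_measure R, forall x, A x ->
    n x * \1_E x + \int[@lebesgue_measure R]_(y in E) K (x, y) = 0}) ->
  (forall x y, ~ A x -> K (x, y) = 0) ->
  {ae @lebesgue_measure R, forall x, A x -> n x = 0} /\
  {ae (@lebesgue_measure R \x @lebesgue_measure R)%E, forall z, K z = 0}.
Proof.
move=> K2 intK K0T K0E KA.
have K0 : {ae @lebesgue_measure R, forall x, A x ->
    n x = 0 /\ {ae @lebesgue_measure R, forall y, K (x, y) = 0}}.
  (* Enumerating the rationals by [unpickle] moves the quantifier over rays inside the almost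
     everywhere. *)
  have : {ae @lebesgue_measure R, forall x (i : nat), A x ->
      if unpickle i is Some q then
        n x * \1_(`[ratr (q : rat), +oo[) x +
        \int[@lebesgue_measure R]_(y in `[ratr q, +oo[) K (x, y) = 0 else True}.
    apply/ae_foralln => i; case: unpickle => [q|]; last exact: aeW.
    by apply: K0E; exists q.
  apply: (ae_imply3 _ intK K0T) => x ix n0 nq Ax.
  apply: (eq0_of_rational_rays (x := x) ix) => [|_ [q _ <-]]; first exact: n0.
  by have := nq (pickle q) Ax; rewrite pickleK.
split; first by apply: ae_imply K0 => x H /H[].
apply: ae_eq0_of_sections; first exact: Lfun2_measurable K2.
apply: ae_imply K0 => x Kx; have [/Kx[]//|nAx] := pselect (A x).
by apply: aeW => y; exact: KA.
Qed.

(** * Entrywise integrals of matrix-valued functions *)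

(** As a factor it turns integrals and L2 membership on an interval into the same notions on the
    whole line, where the general lemmas are stated. Idempotence ([chi_idem]) lets both factors of a
    product carry it. *)
Definition chi (R : realType) (a b : R) : R -> R := \1_(`[a, b]%classic).

Section chi.
Context (R : realType).
Implicit Types a b s : R.

Lemma chi1 a b s : s \in `[a, b] -> chi a b s = 1.
Proof. by move=> sab; rewrite /chi indicE mem_set. Qed.

Lemma chi0 a b s : s \notin `[a, b] -> chi a b s = 0.
Proof. by move=> sab; rewrite /chi indicE memNset//; exact/negP. Qed.

Lemma chi_idem a b s : chi a b s * chi a b s = chi a b s.
Proof. by rewrite /chi indicE -natrM mulnb andbb. Qed.

Lemma measurable_chi a b : measurable_fun setT (chi a b).
Proof. exact: measurable_indic. Qed.

Lemma patch_chi a b (f : R -> R) :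
  f \_ `[a, b] = fun s => chi a b s * f s.
Proof.
apply/funext => s; rewrite patchE /chi indicE.
by case: ifPn => _; rewrite ?mul1r ?mul0r.
Qed.

Lemma Rintegral_chi a b (f : R -> R) :
  \int[@lebesgue_measure R]_(s in `[a, b]) f s =
  \int[@lebesgue_measure R]_s (chi a b s * f s).
Proof. by rewrite Rintegral_mkcond patch_chi. Qed.

Lemma chi_Rintegral a b s (f : R -> R) :
  chi a b s * \int[@lebesgue_measure R]_t f t =
  \int[@lebesgue_measure R]_t (chi a b s * f t).
Proof.
rewrite /chi indicE; case: (s \in _) => /=.
  by rewrite mul1r; apply: eq_Rintegral => t _; rewrite mul1r.
rewrite mul0r; under eq_Rintegral do rewrite mul0r.
by rewrite /Rintegral integral0.
Qed.

Lemma Lfun2_chi a b : chi a b \in Lfun (@lebesgue_measure R) 2%:E.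
Proof.
apply/Lfun2P; split; first exact: measurable_chi.
under eq_integral do rewrite expr2 chi_idem.
rewrite integral_indic// setIT.
apply: (@le_lt_trans _ _ (@lebesgue_measure R `[a, b])); first exact: lexx.
by rewrite lebesgue_measure_itv/=; case: ifP; rewrite -?EFinB ltry.
Qed.

End chi.

Section mxint.
Context (R : realType).
Implicit Types a b c d : R.
Local Notation mu := (@lebesgue_measure R).

Lemma mxintE n m a b (F : R -> 'M[R]_(n, m)) i j :
  mxint `[a, b] F i j = \int[mu]_s (chi a b s * F s i j).
Proof. by rewrite mxE Rintegral_chi. Qed.

Lemma eq_mxint n m a b (F G : R -> 'M[R]_(n, m)) :
  (forall s, s \in `[a, b] -> F s = G s) -> mxint `[a, b] F = mxint `[a, b] G.
Proof.
move=> FG; apply/matrixP => i j; rewrite !mxE; apply: eq_Rintegral => s.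
by rewrite inE/= => sab; rewrite FG.
Qed.

Definition mx_integrable n m a b (F : R -> 'M[R]_(n, m)) :=
  forall i j, mu.-integrable setT (fun s => (chi a b s * F s i j)%:E).

Lemma mxintD n m a b (F G : R -> 'M[R]_(n, m)) :
  mx_integrable a b F -> mx_integrable a b G ->
  mxint `[a, b] (fun s => F s + G s) = mxint `[a, b] F + mxint `[a, b] G.
Proof.
move=> iF iG; apply/matrixP => i j; rewrite [RHS]mxE !mxintE.
under eq_Rintegral do rewrite mxE mulrDr.
by rewrite (RintegralD _ (iF i j) (iG i j)).
Qed.

Lemma mx_integrableD n m a b (F G : R -> 'M[R]_(n, m)) :
  mx_integrable a b F -> mx_integrable a b G ->
  mx_integrable a b (fun s => F s + G s).
Proof.
move=> iF iG i j; under eq_fun do rewrite mxE mulrDr EFinD.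
exact: (integrableD _ (iF i j) (iG i j)).
Qed.

Lemma mxintZ n m a b k (F : R -> 'M[R]_(n, m)) : mx_integrable a b F ->
  mxint `[a, b] (fun s => k *: F s) = k *: mxint `[a, b] F.
Proof.
move=> iF; apply/matrixP => i j; rewrite [RHS]mxE !mxintE.
under eq_Rintegral do rewrite mxE mulrCA.
by rewrite (RintegralZl _ _ (iF i j)).
Qed.

Lemma mx_integrableZ n m a b k (F : R -> 'M[R]_(n, m)) :
  mx_integrable a b F -> mx_integrable a b (fun s => k *: F s).
Proof.
move=> iF i j; under eq_fun do rewrite mxE mulrCA EFinM.
exact: (integrableZl _ _ (iF i j)).
Qed.

Lemma mxint_mull n m p a b (A : 'M[R]_(p, n)) (F : R -> 'M[R]_(n, m)) :
  mx_integrable a b F ->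
  mxint `[a, b] (fun s => A *m F s) = A *m mxint `[a, b] F.
Proof.
move=> iF; apply/matrixP => i j; rewrite [RHS]mxE mxintE.
transitivity (\sum_k \int[mu]_s (A i k * (chi a b s * F s k j))).
  rewrite /Rintegral sum_fine; last first.
    move=> k _; apply: integrable_fin_num => //.
    exact: (integrableZl _ _ (iF k j)).
  congr fine; rewrite -integral_sum//; last first.
    by move=> k; exact: (integrableZl _ _ (iF k j)).
  apply: eq_integral => s _; rewrite sumEFin mxE mulr_sumr.
  by congr EFin; apply: eq_bigr => k _; rewrite mulrCA.
by apply: eq_bigr => k _; rewrite (RintegralZl _ _ (iF k j))// mxintE.
Qed.

Lemma mxint_tr n m a b (F : R -> 'M[R]_(n, m)) :
  mxint `[a, b] (fun s => (F s)^T) = (mxint `[a, b] F)^T.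
Proof.
apply/matrixP => i j; rewrite [RHS]mxE !mxintE.
by apply: eq_Rintegral => s _; rewrite mxE.
Qed.

Lemma mx_integrable_tr n m a b (F : R -> 'M[R]_(n, m)) :
  mx_integrable a b F -> mx_integrable a b (fun s => (F s)^T).
Proof. by move=> iF i j; under eq_fun do rewrite mxE. Qed.

Lemma mxint_mulr n m p a b (F : R -> 'M[R]_(n, m)) (A : 'M[R]_(m, p)) :
  mx_integrable a b F ->
  mxint `[a, b] (fun s => F s *m A) = mxint `[a, b] F *m A.
Proof.
move=> iF; apply: trmx_inj; rewrite -mxint_tr trmx_mul -mxint_tr.
rewrite -mxint_mull; last exact: mx_integrable_tr.
by congr mxint; apply/funext => s; rewrite trmx_mul.
Qed.

End mxint.

(** * Square-integrable matrix-valued functions *)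

Section L2_closure.
Context (R : realType).
Implicit Types a b c d : R.
Local Notation mu := (@lebesgue_measure R).

Lemma L2_onP n m a b (F : R -> 'M[R]_(n, m)) : L2_on a b F <->
  forall i j, (fun s => chi a b s * F s i j) \in Lfun mu 2%:E.
Proof. by split=> H i j; have := H i j; rewrite patch_chi. Qed.

Lemma L2_on2P n m a b c d (F : R -> R -> 'M[R]_(n, m)) :
  L2_on2 a b c d F <-> forall i j,
    (fun z => chi a b z.1 * chi c d z.2 * F z.1 z.2 i j)
      \in Lfun (mu \x mu)%E 2%:E.
Proof.
have E i j : (fun z : R * R => F z.1 z.2 i j) \_ (`[a, b] `*` `[c, d]) =
    fun z => chi a b z.1 * chi c d z.2 * F z.1 z.2 i j.
  apply/funext => -[x y]; rewrite patchE in_setX /chi !indicE/= -natrM mulnb.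
  by case: ifPn => _; rewrite ?mul1r ?mul0r.
by split=> H i j; have := H i j; rewrite E.
Qed.

Lemma L2_onD n m a b (F G : R -> 'M[R]_(n, m)) :
  L2_on a b F -> L2_on a b G -> L2_on a b (fun s => F s + G s).
Proof.
move=> /L2_onP F2 /L2_onP G2; apply/L2_onP => i j.
under eq_fun do rewrite mxE mulrDr; exact: (Lfun2_add (F2 i j) (G2 i j)).
Qed.

Lemma L2_onZ n m a b k (F : R -> 'M[R]_(n, m)) :
  L2_on a b F -> L2_on a b (fun s => k *: F s).
Proof.
move=> /L2_onP F2; apply/L2_onP => i j.
under eq_fun do rewrite mxE mulrCA; exact: (Lfun2_scale k (F2 i j)).
Qed.

Lemma L2_on_mull n m p a b (A : 'M[R]_(p, n)) (F : R -> 'M[R]_(n, m)) :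
  L2_on a b F -> L2_on a b (fun s => A *m F s).
Proof.
move=> /L2_onP F2; apply/L2_onP => i j; under eq_fun do
  (rewrite mxE mulr_sumr; under eq_bigr do rewrite mulrCA); rewrite /=.
apply: Lfun2_sum => k; exact: (Lfun2_scale (A i k) (F2 k j)).
Qed.

Lemma L2_on_mulr n m p a b (F : R -> 'M[R]_(n, m)) (A : 'M[R]_(m, p)) :
  L2_on a b F -> L2_on a b (fun s => F s *m A).
Proof.
move=> /L2_onP F2; apply/L2_onP => i j; under eq_fun do
  (rewrite mxE mulr_sumr; under eq_bigr do rewrite mulrA mulrC); rewrite /=.
apply: Lfun2_sum => k; exact: (Lfun2_scale (A k j) (F2 i k)).
Qed.

Lemma L2_on_cst n m a b (A : 'M[R]_(n, m)) : L2_on a b (fun=> A).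
Proof.
apply/L2_onP => i j; under eq_fun do rewrite mulrC.
exact: (Lfun2_scale (A i j) (Lfun2_chi a b)).
Qed.

Lemma L2_on2D n m a b c d (F G : R -> R -> 'M[R]_(n, m)) :
  L2_on2 a b c d F -> L2_on2 a b c d G ->
  L2_on2 a b c d (fun x y => F x y + G x y).
Proof.
move=> /L2_on2P F2 /L2_on2P G2; apply/L2_on2P => i j.
under eq_fun do rewrite mxE mulrDr; exact: (Lfun2_add (F2 i j) (G2 i j)).
Qed.

Lemma L2_on2Z n m a b c d k (F : R -> R -> 'M[R]_(n, m)) :
  L2_on2 a b c d F -> L2_on2 a b c d (fun x y => k *: F x y).
Proof.
move=> /L2_on2P F2; apply/L2_on2P => i j.
under eq_fun do rewrite mxE mulrCA; exact: (Lfun2_scale k (F2 i j)).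
Qed.

Lemma L2_on2_weight n m a b c d (w : R -> R -> R) (F : R -> R -> 'M[R]_(n, m)) :
  measurable_fun setT (fun z : R * R => w z.1 z.2) ->
  (forall x y, `|w x y| <= 1) ->
  L2_on2 a b c d F -> L2_on2 a b c d (fun x y => w x y *: F x y).
Proof.
move=> mw w1 /L2_on2P F2; apply/L2_on2P => i j.
under eq_fun do rewrite mxE mulrCA.
have := @Lfun2_weight _ _ _ (mu \x mu)%E (fun z => w z.1 z.2) _ mw _ (F2 i j).
by apply=> z; exact: w1.
Qed.

Lemma L2_on2_tensor n m p a b c d (F : R -> 'M[R]_(n, p))
    (G : R -> 'M[R]_(p, m)) :
  L2_on a b F -> L2_on c d G -> L2_on2 a b c d (fun x y => F x *m G y).
Proof.
move=> /L2_onP F2 /L2_onP G2; apply/L2_on2P => i j; under eq_fun do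
  (rewrite mxE mulr_sumr; under eq_bigr do rewrite mulrACA); rewrite /=.
apply: Lfun2_sum => k; exact: (Lfun2_tensor (F2 i k) (G2 k j)).
Qed.

Lemma L2_on2_swap n m a b c d (F : R -> R -> 'M[R]_(n, m)) :
  L2_on2 a b c d F -> L2_on2 c d a b (fun y x => F x y).
Proof.
move=> /L2_on2P F2; apply/L2_on2P => i j.
under eq_fun do rewrite (mulrC (chi c d _)).
exact: (Lfun2_swap (F2 i j)).
Qed.

Lemma L2_on2_fst n m a b c d (F : R -> 'M[R]_(n, m)) :
  L2_on a b F -> L2_on2 a b c d (fun x _ => F x).
Proof.
move=> F2; have := L2_on2_tensor F2 (@L2_on_cst _ _ c d 1%:M).
by under eq_fun do under eq_fun do rewrite mulmx1.
Qed.

Lemma L2_on2_snd n m a b c d (F : R -> 'M[R]_(n, m)) :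
  L2_on c d F -> L2_on2 a b c d (fun _ y => F y).
Proof. by move=> F2; apply: L2_on2_swap; exact: L2_on2_fst. Qed.

Lemma L2_on2_section n m a b c d (F : R -> R -> 'M[R]_(n, m)) :
  L2_on2 a b c d F ->
  {ae mu, forall x, x \in `[a, b] -> L2_on c d (F x)}.
Proof.
move=> /L2_on2P F2.
suff H i j : {ae mu, forall x, x \in `[a, b] ->
    (fun s => chi c d s * F x s i j) \in Lfun mu 2%:E}.
  apply: ae_imply (ae_forall_fin (fun i => ae_forall_fin (H i))) => x Hx xab.
  by apply/L2_onP => i j; exact: Hx.
have S := Lfun2_section (F2 i j); apply: ae_imply S => x + xab.
by under eq_fun do rewrite /= (chi1 xab) mul1r.
Qed.

(** [[c, d]] has positive measure, so one of its points avoids the null set of bad sections. Thanks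
    to this, one-variable closure properties follow from two-variable ones by adding a dummy
    variable in [[0, 1]]. *)
Lemma L2_on_fst n m a b c d (F : R -> 'M[R]_(n, m)) : c < d ->
  L2_on2 a b c d (fun x _ => F x) -> L2_on a b F.
Proof.
move=> cd /L2_on2_swap/L2_on2_section[N [mN N0 FN]].
have [y yN ycd] : exists2 y, ~ N y & y \in `[c, d].
  apply: contrapT => H.
  have sub : `[c, d]%classic `<=` N.
    by move=> y ycd; apply: contrapT => yN; apply: H; exists y.
  have : (mu `[c, d] <= mu N)%E by apply: le_measure; rewrite ?inE.
  rewrite [X in (_ <= X)%E]N0 lebesgue_measure_itv/= lte_fin cd -EFinB.
  by rewrite lee_fin leNgt subr_gt0 cd.
apply: contrapT => H; apply: yN; apply: FN => /= /(_ ycd) HH.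
exact: H.
Qed.

End L2_closure.

(** * Compositions, Fubini and multiplication operators *)

Section L2_products.
Context (R : realType).
Implicit Types a b c d e f : R.
Local Notation mu := (@lebesgue_measure R).

Lemma chi_norm_le1 a b (s : R) : `|chi a b s| <= 1.
Proof. by rewrite /chi indicE; case: (_ \in _); rewrite ?normr1 ?normr0. Qed.

Lemma L2_on_weight n m a b (w : R -> R) (F : R -> 'M[R]_(n, m)) :
  measurable_fun setT w -> (forall x, `|w x| <= 1) ->
  L2_on a b F -> L2_on a b (fun s => w s *: F s).
Proof.
move=> mw w1 /L2_onP F2; apply/L2_onP => i j.
under eq_fun do rewrite mxE mulrCA.
by have := @Lfun2_weight _ _ _ mu w _ mw _ (F2 i j); apply.
Qed.

Lemma mx_integrableM n m p a b (F : R -> 'M[R]_(n, p)) (G : R -> 'M[R]_(p, m)) :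
  L2_on a b F -> L2_on a b G -> mx_integrable a b (fun s => F s *m G s).
Proof.
move=> /L2_onP F2 /L2_onP G2 i j.
under eq_fun do rewrite mxE mulr_sumr -sumEFin.
apply: (integrable_sum measurableT) => k _.
have := Lfun2_integrableM (F2 i k) (G2 k j).
by under eq_fun do rewrite mulrACA chi_idem.
Qed.

Lemma mx_integrableM_weight n m p a b (w : R -> R) (F : R -> 'M[R]_(n, p))
    (G : R -> 'M[R]_(p, m)) :
  measurable_fun setT w -> (forall x, `|w x| <= 1) ->
  L2_on a b F -> L2_on a b G ->
  mx_integrable a b (fun s => w s *: (F s *m G s)).
Proof.
move=> mw w1 F2 G2; under eq_fun do rewrite scalemxAl.
by apply: mx_integrableM => //; exact: L2_on_weight.
Qed.

(** The weight covers at once the plain composition and every density among the [Phi] and [Psi]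
    kernels. *)
Lemma L2_on2_comp_weight n m p a b c d e f (w : R -> R -> R -> R)
    (F : R -> R -> 'M[R]_(n, p)) (G : R -> R -> 'M[R]_(p, m)) :
  measurable_fun setT (fun t : (R * R) * R => w t.1.1 t.2 t.1.2) ->
  (forall x y z, `|w x y z| <= 1) ->
  L2_on2 a b c d F -> L2_on2 c d e f G ->
  L2_on2 a b e f
    (fun x z => mxint `[c, d] (fun y => w x y z *: (F x y *m G y z))).
Proof.
move=> mw w1 /L2_on2P F2 /L2_on2P G2; apply/L2_on2P => i j.
have := @Lfun2_kernel_comp_sum _ _ _ _ _ _ R mu mu mu _
  (fun k z => chi a b z.1 * chi c d z.2 * F z.1 z.2 i k)
  (fun k z => chi c d z.1 * chi e f z.2 * G z.1 z.2 k j)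
  (fun t : (R * R) * R => w t.1.1 t.2 t.1.2) (fun k => F2 i k) (fun k => G2 k j)
  mw (fun t => w1 _ _ _).
rewrite (_ : (fun xz => _) = (fun z : R * R => chi a b z.1 * chi e f z.2 *
   mxint `[c, d] (fun y => w z.1 y z.2 *: (F z.1 y *m G y z.2)) i j))//.
apply/funext => -[x z] /=; rewrite mxintE -mulrA 2!chi_Rintegral.
apply: eq_Rintegral => y _; rewrite !mxE.
rewrite [in RHS]mulrCA ![in RHS]mulrA ![in LHS]mulr_sumr ![in RHS]mulr_sumr.
apply: eq_bigr => k _; rewrite -[in RHS](chi_idem c d); ring.
Qed.

Lemma L2_on2_comp n m p a b c d e f
    (F : R -> R -> 'M[R]_(n, p)) (G : R -> R -> 'M[R]_(p, m)) :
  L2_on2 a b c d F -> L2_on2 c d e f G ->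
  L2_on2 a b e f (fun x z => mxint `[c, d] (fun y => F x y *m G y z)).
Proof.
move=> F2 G2.
rewrite (_ : (fun x z => _) = (fun x z =>
    mxint `[c, d] (fun y => 1 *: (F x y *m G y z)))); last first.
  apply/funext => x; apply/funext => z; apply: eq_mxint => y _.
  by rewrite scale1r.
apply: (@L2_on2_comp_weight _ _ _ a b c d e f (fun _ _ _ => 1)) => //.
by move=> *; rewrite normr1.
Qed.

Lemma L2_on_comp_weight_r n m p a b c d (w : R -> R -> R)
    (F : R -> R -> 'M[R]_(n, p)) (G : R -> 'M[R]_(p, m)) :
  measurable_fun setT (fun t : R * R => w t.1 t.2) ->
  (forall x y, `|w x y| <= 1) ->
  L2_on2 a b c d F -> L2_on c d G ->
  L2_on a b (fun x => mxint `[c, d] (fun y => w x y *: (F x y *m G y))).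
Proof.
move=> mw w1 F2 G2; apply: (@L2_on_fst _ _ _ _ _ 0 1) => //.
apply: (@L2_on2_comp_weight _ _ _ a b c d 0 1 (fun x y _ => w x y) F
  (fun y _ => G y)) => //; last exact: L2_on2_fst.
have mp : measurable_fun setT (fun t : (R * R) * R => (t.1.1, t.2)).
  apply: measurable_fun_pair => //.
  exact: (measurableT_comp measurable_fst measurable_fst).
exact: (measurableT_comp mw mp).
Qed.

Lemma L2_on_comp_r n m p a b c d
    (F : R -> R -> 'M[R]_(n, p)) (G : R -> 'M[R]_(p, m)) :
  L2_on2 a b c d F -> L2_on c d G ->
  L2_on a b (fun x => mxint `[c, d] (fun y => F x y *m G y)).
Proof.
move=> F2 G2; apply: (@L2_on_fst _ _ _ _ _ 0 1) => //.
by apply: (L2_on2_comp F2); exact: L2_on2_fst.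
Qed.

Lemma L2_on_comp_l n m p a b c d
    (F : R -> 'M[R]_(n, p)) (G : R -> R -> 'M[R]_(p, m)) :
  L2_on a b F -> L2_on2 a b c d G ->
  L2_on c d (fun y => mxint `[a, b] (fun x => F x *m G x y)).
Proof.
move=> F2 G2; apply: (@L2_on_fst _ _ _ _ _ 0 1) => //.
by apply: L2_on2_swap; apply: L2_on2_comp G2; exact: L2_on2_snd.
Qed.

(** Associativity of row, kernel and function. The integrand is integrable on the rectangle because,
    entry by entry, it pairs the L2 function [G] with the tensor product of [F] and [U], again in
    L2. *)
Lemma mxint_Fubini n m p q a b c d (F : R -> 'M[R]_(n, p))
    (G : R -> R -> 'M[R]_(p, q)) (U : R -> 'M[R]_(q, m)) :
  L2_on a b F -> L2_on2 a b c d G -> L2_on c d U ->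
  mxint `[a, b] (fun x => F x *m mxint `[c, d] (fun y => G x y *m U y)) =
  mxint `[c, d] (fun y => mxint `[a, b] (fun x => F x *m G x y) *m U y).
Proof.
move=> F2 G2 U2; apply/matrixP => i j; rewrite !mxintE.
pose H x y := F x *m G x y *m U y.
have intH : (mu \x mu)%E.-integrable setT
    (EFin \o (fun z => chi a b z.1 * chi c d z.2 * H z.1 z.2 i j)).
  rewrite (_ : EFin \o _ = fun z => (\sum_l \sum_k
      ((chi a b z.1 * chi c d z.2 * G z.1 z.2 k l) *
      ((chi a b z.1 * F z.1 i k) * (chi c d z.2 * U z.2 l j)))%:E)%E); last first.
    apply/funext => z /=; under eq_bigr do rewrite sumEFin.
    rewrite sumEFin; congr EFin; rewrite /H mxE mulr_sumr.
    apply: eq_bigr => l _; rewrite mxE mulr_suml mulr_sumr; apply: eq_bigr => k _.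
    rewrite -[in LHS](chi_idem a b) -[in LHS](chi_idem c d); ring.
  apply: (integrable_sum measurableT) => l _.
  apply: (integrable_sum measurableT) => k _.
  move/L2_on2P : (G2) => /(_ k l) Gkl.
  move/L2_onP : (F2) => /(_ i k) Fik.
  move/L2_onP : (U2) => /(_ l j) Ulj.
  exact: (Lfun2_integrableM Gkl (Lfun2_tensor Fik Ulj)).
have mH : measurable_fun setT
    (fun z : R * R => chi a b z.1 * chi c d z.2 * H z.1 z.2 i j).
  by apply/measurable_EFinP; exact: measurable_int intH.
have GU2 := L2_on_comp_r G2 U2.
have FG2 := L2_on_comp_l F2 G2.
transitivity (\int[mu]_x \int[mu]_y (chi a b x * chi c d y * H x y i j)).
  apply: ae_eq_Rintegral.
  - apply/measurable_EFinP; exact: measurable_int (mx_integrableM F2 GU2 i j).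
  - exact: (@measurable_Rintegral _ _ _ _ _ mu _ mH).
  apply: ae_imply (L2_on2_section G2) => x Gx.
  have [xab|xab] := boolP (x \in `[a, b]); last first.
    rewrite (chi0 xab) mul0r; under eq_Rintegral do rewrite !mul0r.
    by rewrite /Rintegral integral0.
  (* Moving [F x] under the inner integral requires row [x] of [G] to be L2, hence the almost
     everywhere equality of outer integrands. *)
  rewrite -mxint_mull; last exact: mx_integrableM (Gx xab) U2.
  rewrite mxintE chi_Rintegral; apply: eq_Rintegral => y _.
  by rewrite /H mulmxA mulrA.
rewrite (Rintegral_Fubini intH); apply: ae_eq_Rintegral.
- apply: (@measurable_Rintegral _ _ _ _ _ mu (fun z : R * R =>
    chi a b z.2 * chi c d z.1 * H z.2 z.1 i j)).
  exact: (measurableT_comp mH (@measurable_swap _ _ _ _)).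
- apply/measurable_EFinP; exact: measurable_int (mx_integrableM FG2 U2 i j).
apply: ae_imply (L2_on2_section (L2_on2_swap G2)) => y Gy /=.
have [ycd|ycd] := boolP (y \in `[c, d]); last first.
  rewrite (chi0 ycd) mul0r; under eq_Rintegral do rewrite mulr0 mul0r.
  by rewrite /Rintegral integral0.
rewrite -mxint_mulr; last exact: mx_integrableM F2 (Gy ycd).
rewrite mxintE chi_Rintegral; apply: eq_Rintegral => x _.
by rewrite mulrA (mulrC (chi c d y)).
Qed.

(* This is all that is needed of the operator hypothesis on the diagonal
   parameters: they map L2 to L2; essential boundedness is never derived. *)
Definition multiplier n m a b (N : R -> 'M[R]_(n, m)) :=
  forall i j (g : R -> R), (fun s => chi a b s * g s) \in Lfun mu 2%:E ->
    (fun s => chi a b s * (N s i j * g s)) \in Lfun mu 2%:E.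

Lemma multiplier_L2 n m a b (N : R -> 'M[R]_(n, m)) :
  multiplier a b N -> L2_on a b N.
Proof.
move=> multN; apply/L2_onP => i j.
rewrite (_ : (fun s => _) = fun s => chi a b s * (N s i j * cst 1 s)).
  apply: multN; rewrite (_ : (fun s => _) = chi a b); first exact: Lfun2_chi.
  by apply/funext => s; rewrite mulr1.
by apply/funext => s; rewrite mulr1.
Qed.

Lemma multiplierM n m p a b (M : R -> 'M[R]_(n, p)) (N : R -> 'M[R]_(p, m)) :
  multiplier a b M -> multiplier a b N -> multiplier a b (fun s => M s *m N s).
Proof.
move=> multM multN i j g g2.
rewrite (_ : (fun s => _) =
    fun s => \sum_k chi a b s * (M s i k * (N s k j * g s))); last first.
  apply/funext => s; rewrite mxE mulr_suml mulr_sumr.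
  by apply: eq_bigr => k _; rewrite -mulrA.
by apply: Lfun2_sum => k; apply: multM; exact: multN.
Qed.

Lemma L2_on_multl n m p a b (N : R -> 'M[R]_(n, p)) (F : R -> 'M[R]_(p, m)) :
  multiplier a b N -> L2_on a b F -> L2_on a b (fun s => N s *m F s).
Proof.
move=> multN /L2_onP F2; apply/L2_onP => i j.
under eq_fun do rewrite mxE mulr_sumr.
by apply: Lfun2_sum => k; apply: multN; exact: F2.
Qed.

Lemma L2_on_multr n m p a b (F : R -> 'M[R]_(n, p)) (N : R -> 'M[R]_(p, m)) :
  multiplier a b N -> L2_on a b F -> L2_on a b (fun s => F s *m N s).
Proof.
move=> multN /L2_onP F2; apply/L2_onP => i j.
rewrite (_ : (fun s => _) = fun s =>
    \sum_k chi a b s * (N s k j * F s i k)); last first.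
  apply/funext => s; rewrite mxE mulr_sumr.
  by apply: eq_bigr => k _; rewrite (mulrC (F s i k)).
by apply: Lfun2_sum => k; apply: multN; exact: F2.
Qed.

Lemma Lfun2_mult2 n m a b c d (N : R -> 'M[R]_(n, m)) i j (G : R * R -> R) :
  multiplier a b N ->
  (fun z => chi a b z.1 * chi c d z.2 * G z) \in Lfun (mu \x mu)%E 2%:E ->
  (fun z => chi a b z.1 * chi c d z.2 * (N z.1 i j * G z))
    \in Lfun (mu \x mu)%E 2%:E.
Proof.
move=> multN G2; have N2 := multiplier_L2 multN; move/L2_onP : N2 => /(_ i j) N2.
have := @Lfun2_mul_section _ _ _ _ _ mu mu (fun x => chi a b x * N x i j) _
  (Lfun2_measurable N2) _ G2.
rewrite (_ : (fun z => _ * (_ * G z)) =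
    fun z => chi a b z.1 * chi c d z.2 * (N z.1 i j * G z)); last first.
  by apply/funext => z; rewrite -[in RHS](chi_idem a b); ring.
apply=> h h2; rewrite (_ : (fun x => _) =
    fun x => chi a b x * (N x i j * h x)).
  apply: multN; apply: Lfun2_weight h2; first exact: measurable_chi.
  exact: chi_norm_le1.
by apply/funext => x; rewrite mulrA.
Qed.

Lemma L2_on2_multl n m p a b c d (N : R -> 'M[R]_(n, p))
    (F : R -> R -> 'M[R]_(p, m)) : multiplier a b N -> L2_on2 a b c d F ->
  L2_on2 a b c d (fun x y => N x *m F x y).
Proof.
move=> multN /L2_on2P F2; apply/L2_on2P => i j.
under eq_fun do rewrite mxE mulr_sumr.
apply: Lfun2_sum => k.
exact: (Lfun2_mult2 (G := fun z => F z.1 z.2 k j) i k multN (F2 k j)).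
Qed.

Lemma L2_on2_multr n m p a b c d (F : R -> R -> 'M[R]_(n, p))
    (N : R -> 'M[R]_(p, m)) : multiplier c d N -> L2_on2 a b c d F ->
  L2_on2 a b c d (fun x y => F x y *m N y).
Proof.
move=> multN /L2_on2_swap/L2_on2P F2; apply/L2_on2_swap/L2_on2P => i j.
rewrite (_ : (fun z => _) = fun z => \sum_k chi c d z.1 * chi a b z.2 *
    (N z.1 k j * F z.2 z.1 i k)); last first.
  apply/funext => z; rewrite mxE mulr_sumr.
  by apply: eq_bigr => k _; rewrite (mulrC (F _ _ i k)).
apply: Lfun2_sum => k.
exact: (Lfun2_mult2 (G := fun z => F z.2 z.1 i k) k j multN (F2 i k)).
Qed.

End L2_products.

(** * Kernels of PI operators *)

Lemma measurable_bool_natr d (T : measurableType d) (R : realType)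
    (b : T -> bool) : measurable_fun setT b ->
  measurable_fun setT (fun t => (b t)%:R : R).
Proof.
move=> mb; rewrite (_ : (fun t => _) = fun t => if b t then 1 else 0 : R).
  by apply: measurable_fun_if.
by apply/funext => t; case: (b t).
Qed.

Lemma measurable_kI d (T : measurableType d) (R : realType) (f g : T -> R) :
  measurable_fun setT f -> measurable_fun setT g ->
  measurable_fun setT (fun t => kI (f t) (g t)).
Proof.
by move=> mf mg; apply: measurable_bool_natr; exact: measurable_fun_ltr.
Qed.

Lemma measurable_kH d (T : measurableType d) (R : realType) (f g h : T -> R) :
  measurable_fun setT f -> measurable_fun setT g -> measurable_fun setT h ->
  measurable_fun setT (fun t => kH (f t) (g t) (h t)).
Proof.
move=> mf mg mh; rewrite (_ : (fun t => _) =
    fun t => kI (g t) (h t) * kI (f t) (g t)); last first.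
  by apply/funext => t; rewrite /kI /kH -natrM mulnb.
by apply: measurable_funM; exact: measurable_kI.
Qed.

Lemma norm_bool_le1 (R : realType) (b : bool) : `|b%:R : R| <= 1.
Proof. by case: b; rewrite ?normr1 ?normr0. Qed.

(** What makes [kint] linear on products of L2 functions: evaluation at a point always is, and a
    bounded measurable density preserves integrability. *)
Definition bounded_kernel (R : realType) (K : Defs.kernel R) :=
  match K with
  | Delta _ => True
  | Density w => measurable_fun setT w /\ forall s, `|w s| <= 1
  end.

Section kernels.
Context (R : realType).
Implicit Types a b c d s x theta : R.
Local Notation mu := (@lebesgue_measure R).

Lemma bounded_Phi_fst i theta : bounded_kernel (Phi_fst i theta).
Proof.
case: i => [|[|i]] //=; (split; last by move=> s; exact: norm_bool_le1).
- by apply: measurable_kI => //; exact: measurable_cst.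
- by apply: measurable_kI => //; exact: measurable_cst.
Qed.

Lemma bounded_Phi_snd i x : bounded_kernel (Phi_snd i x).
Proof.
case: i => [|[|i]] //=; (split; last by move=> s; exact: norm_bool_le1).
- by apply: measurable_kI => //; exact: measurable_cst.
- by apply: measurable_kI => //; exact: measurable_cst.
Qed.

Lemma bounded_Psi k i j x theta : bounded_kernel (Psi k i j x theta).
Proof.
case: k i j => [|[|[|k]]] [|[|[|i]]] [|[|[|j]]] //=; split;
  try (by move=> s; exact: norm_bool_le1); try (by move=> s; rewrite normr0);
  try exact: measurable_cst;
  by [apply: measurable_kI => //; exact: measurable_cst
     |apply: measurable_kH => //; exact: measurable_cst].
Qed.

Lemma kint_lin n m p a b (K : Defs.kernel R) k
    (F : R -> 'M[R]_(n, p)) (G : R -> 'M[R]_(p, m))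
    (F' : R -> 'M[R]_(n, p)) (G' : R -> 'M[R]_(p, m)) : bounded_kernel K ->
  L2_on a b F -> L2_on a b G -> L2_on a b F' -> L2_on a b G' ->
  kint a b K (fun s => k *: (F s *m G s) + F' s *m G' s) =
  k *: kint a b K (fun s => F s *m G s) + kint a b K (fun s => F' s *m G' s).
Proof.
case: K => [//|w] [mw w1] F2 G2 F'2 G'2 /=.
have iFG := mx_integrableM_weight mw w1 F2 G2.
have iFG' := mx_integrableM_weight mw w1 F'2 G'2.
rewrite -mxintZ// -mxintD//; last exact: mx_integrableZ.
by apply: eq_mxint => s _; rewrite scalerDr !scalerA mulrC.
Qed.

(* The lower and upper triangular parts as one kernel on the square; the
   diagonal, where both indicators vanish, is negligible. *)
Definition fullker n m (N : par1D R n m) s sigma : 'M[R]_(n, m) :=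
  kI s sigma *: N1 N s sigma + kI sigma s *: N2 N s sigma.

Lemma L2_on2_fullker n m a b (N : par1D R n m) : in_N1D a b N ->
  L2_on2 a b a b (fullker N).
Proof.
case=> N02 N12 N22; apply: L2_on2D; apply: L2_on2_weight => //.
- exact: measurable_kI measurable_fst measurable_snd.
- by move=> x y; exact: norm_bool_le1.
- exact: measurable_kI measurable_snd measurable_fst.
- by move=> x y; exact: norm_bool_le1.
Qed.

Lemma eq_L2_on n m a b (F G : R -> 'M[R]_(n, m)) :
  (forall s, s \in `[a, b] -> F s = G s) -> L2_on a b F -> L2_on a b G.
Proof.
move=> FG /L2_onP F2; apply/L2_onP => i j.
rewrite (_ : (fun s => _) = fun s => chi a b s * F s i j)//.
apply/funext => s; have [sab|sab] := boolP (s \in `[a, b]).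
  by rewrite FG.
by rewrite chi0// !mul0r.
Qed.

Lemma ae_eq_mxint n m a b (F G : R -> 'M[R]_(n, m)) :
  mx_integrable a b F -> mx_integrable a b G ->
  {ae mu, forall s, s \in `[a, b] -> F s = G s} ->
  mxint `[a, b] F = mxint `[a, b] G.
Proof.
move=> iF iG FG; apply/matrixP => i j; rewrite !mxintE; apply: ae_eq_Rintegral.
- by apply/measurable_EFinP; exact: measurable_int (iF i j).
- by apply/measurable_EFinP; exact: measurable_int (iG i j).
apply: ae_imply FG => s FGs; have [sab|sab] := boolP (s \in `[a, b]).
  by rewrite FGs.
by rewrite chi0// !mul0r.
Qed.

Lemma ae_neq (x : R) : {ae mu, forall y, y != x}.
Proof.
exists [set x]; split; [exact: measurable_set1|exact: lebesgue_measure_set1|].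
by move=> y /negP; rewrite negbK => /eqP.
Qed.

Lemma mxint_lower n m a b s (F : R -> 'M[R]_(n, m)) : s \in `[a, b] ->
  mxint `[a, s] F = mxint `[a, b] (fun sigma => (sigma <= s)%R%:R *: F sigma).
Proof.
move=> sab; apply/matrixP => i j; rewrite !mxintE.
apply: eq_Rintegral => t _; rewrite mxE mulrA; congr (_ * _).
rewrite /chi !indicE -natrM mulnb; congr (nat_of_bool _)%:R.
rewrite !mem_setE !in_itv/= -andbA; congr andb.
move: sab; rewrite in_itv/= => /andP[_ sb].
by case: (leP t s) => [ts|]; rewrite ?andbT ?andbF// (le_trans ts).
Qed.

Lemma mxint_upper n m a b s (F : R -> 'M[R]_(n, m)) : s \in `[a, b] ->
  mxint `[s, b] F = mxint `[a, b] (fun sigma => (s <= sigma)%R%:R *: F sigma).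
Proof.
move=> sab; apply/matrixP => i j; rewrite !mxintE.
apply: eq_Rintegral => t _; rewrite mxE mulrA; congr (_ * _).
rewrite /chi !indicE -natrM mulnb; congr (nat_of_bool _)%:R.
rewrite !mem_setE !in_itv/=.
move: sab; rewrite in_itv/= => /andP[sa _].
by case: (leP s t) => [st|]; rewrite ?andbT ?andbF// (le_trans sa).
Qed.

(** The closed intervals of [P1D] give non-strict indicators and [fullker] has strict ones; they
    differ at the single point [t = s]. *)
Lemma P1D_E n m a b (N : par1D R n m) (u : R -> 'cV[R]_m) s :
  s \in `[a, b] -> L2_on a b (N1 N s) -> L2_on a b (N2 N s) -> L2_on a b u ->
  P1D a b N u s = N0 N s *m u s + mxint `[a, b] (fun t => fullker N s t *m u t).
Proof.
move=> sab N12 N22 u2; rewrite /P1D -addrA; congr (_ + _).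
rewrite (mxint_lower _ sab) (mxint_upper _ sab).
have mle : measurable_fun setT (fun t : R => (t <= s)%R%:R : R).
  by apply: measurable_bool_natr; apply: measurable_fun_ler.
have mge : measurable_fun setT (fun t : R => (s <= t)%R%:R : R).
  by apply: measurable_bool_natr; apply: measurable_fun_ler.
have mlt : measurable_fun setT (fun t => kI s t).
  by apply: measurable_kI => //; exact: measurable_cst.
have mgt : measurable_fun setT (fun t => kI t s).
  by apply: measurable_kI => //; exact: measurable_cst.
have i1 := mx_integrableM_weight mle (fun t => norm_bool_le1 _ _) N12 u2.
have i2 := mx_integrableM_weight mge (fun t => norm_bool_le1 _ _) N22 u2.
rewrite -mxintD//; apply: ae_eq_mxint.
- exact: mx_integrableD.
- apply: mx_integrableM => //; apply: L2_onD; apply: L2_on_weight => // t.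
  + exact: norm_bool_le1.
  + exact: norm_bool_le1.
apply: ae_imply (ae_neq s) => t ts _; rewrite /fullker mulmxDl -!scalemxAl /kI.
by rewrite !lt_neqAle ts eq_sym ts.
Qed.

(** The hypothesis bears on the product [N0 u] rather than on [N0], so that the lemma also serves
    with [N0 = 0], before any multiplier property is known. *)
Lemma L2_on_P1D n m a b (N : par1D R n m) (u : R -> 'cV[R]_m) :
  L2_on a b (fun s => N0 N s *m u s) ->
  L2_on2 a b a b (N1 N) -> L2_on2 a b a b (N2 N) -> L2_on a b u ->
  L2_on a b (P1D a b N u).
Proof.
move=> N0u N12 N22 u2; rewrite /P1D; apply: L2_onD; first apply: L2_onD => //.
- apply: (@eq_L2_on _ _ _ _ (fun s => mxint `[a, b] (fun t =>
      (t <= s)%R%:R *: (N1 N s t *m u t)))).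
    by move=> s sab; rewrite (mxint_lower _ sab).
  apply: L2_on_comp_weight_r => //; last by move=> *; exact: norm_bool_le1.
  by apply: measurable_bool_natr; apply: measurable_fun_ler.
- apply: (@eq_L2_on _ _ _ _ (fun s => mxint `[a, b] (fun t =>
      (s <= t)%R%:R *: (N2 N s t *m u t)))).
    by move=> s sab; rewrite (mxint_upper _ sab).
  apply: L2_on_comp_weight_r => //; last by move=> *; exact: norm_bool_le1.
  by apply: measurable_bool_natr; apply: measurable_fun_ler.
Qed.

End kernels.

(** * Products of PI kernels *)

Section kernel_products.
Context (R : realType).
Implicit Types a b c d s x y theta : R.
Local Notation mu := (@lebesgue_measure R).

Lemma mxint_scale0 n m a b (F : R -> 'M[R]_(n, m)) :
  mxint `[a, b] (fun s => 0 *: F s) = 0.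
Proof.
apply/matrixP => i j; rewrite mxintE [RHS]mxE.
under eq_Rintegral do rewrite scale0r mxE mulr0.
by rewrite /Rintegral integral0.
Qed.

Lemma mul_kerE n p m a b (F : R -> 'M[R]_(n, p)) (N : par1D R p m) theta :
  mul_ker a b F N theta = F theta *m N0 N theta
  + mxint `[a, b] (fun eta => kI eta theta *: (F eta *m N1 N eta theta))
  + mxint `[a, b] (fun eta => kI theta eta *: (F eta *m N2 N eta theta)).
Proof. by rewrite /mul_ker !big_ord_recl big_ord0 addr0 addrA. Qed.

Lemma ker_mulE n p m a b (N : par1D R n p) (G : R -> 'M[R]_(p, m)) x :
  ker_mul a b N G x = N0 N x *m G x
  + mxint `[a, b] (fun eta => kI x eta *: (N1 N x eta *m G eta))
  + mxint `[a, b] (fun eta => kI eta x *: (N2 N x eta *m G eta)).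
Proof. by rewrite /ker_mul !big_ord_recl big_ord0 addr0 addrA. Qed.

Lemma ker_kerE n p m a b k (N : par1D R n p) (M : par1D R p m) x theta :
  let f i j := kint a b (Psi k i j x theta)
    (fun eta => ker N i x eta *m ker M j eta theta) in
  ker_ker a b k N M x theta =
  f 0%N 0%N + f 0%N 1%N + f 0%N 2%N + (f 1%N 0%N + f 1%N 1%N + f 1%N 2%N)
  + (f 2%N 0%N + f 2%N 1%N + f 2%N 2%N).
Proof.
move=> f; have sum3 (g : nat -> 'M[R]_(n, m)) :
    \sum_(i < 3) g i = g 0%N + g 1%N + g 2%N.
  by rewrite !big_ord_recl big_ord0 addr0 addrA.
rewrite -(sum3 (fun i => f i 0%N + f i 1%N + f i 2%N)).
by apply: eq_bigr => i _; exact: (sum3 (f i)).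
Qed.

Lemma ker_ker1E n p m a b (N : par1D R n p) (M : par1D R p m) x theta :
  ker_ker a b 1 N M x theta = N0 N x *m N1 M x theta
  + N1 N x theta *m N0 M theta
  + mxint `[a, b] (fun eta => kH x eta theta *: (N1 N x eta *m N1 M eta theta))
  + mxint `[a, b] (fun eta => kI theta eta *: (N1 N x eta *m N2 M eta theta))
  + mxint `[a, b] (fun eta => kI eta x *: (N2 N x eta *m N1 M eta theta)).
Proof.
have z i j : Psi 1 i j x theta = Density (fun=> 0) ->
    kint a b (Psi 1 i j x theta)
      (fun eta => ker N i x eta *m ker M j eta theta) = 0.
  by move=> ->; exact: mxint_scale0.
rewrite ker_kerE (z 0%N 0%N erefl) (z 0%N 2%N erefl).
rewrite (z 2%N 0%N erefl) (z 2%N 2%N erefl).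
have sumE (V : zmodType) (A1 A2 A3 A4 A5 : V) :
    0 + A1 + 0 + (A2 + A3 + A4) + (0 + A5 + 0) = A1 + A2 + A3 + A4 + A5.
  by rewrite !addr0 !add0r !addrA.
exact: sumE.
Qed.

Lemma ker_ker2E n p m a b (N : par1D R n p) (M : par1D R p m) x theta :
  ker_ker a b 2 N M x theta = N0 N x *m N2 M x theta
  + mxint `[a, b] (fun eta => kI x eta *: (N1 N x eta *m N2 M eta theta))
  + N2 N x theta *m N0 M theta
  + mxint `[a, b] (fun eta => kI eta theta *: (N2 N x eta *m N1 M eta theta))
  + mxint `[a, b] (fun eta => kH theta eta x *: (N2 N x eta *m N2 M eta theta)).
Proof.
have z i j : Psi 2 i j x theta = Density (fun=> 0) ->
    kint a b (Psi 2 i j x theta)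
      (fun eta => ker N i x eta *m ker M j eta theta) = 0.
  by move=> ->; exact: mxint_scale0.
rewrite ker_kerE (z 0%N 0%N erefl) (z 0%N 1%N erefl).
rewrite (z 1%N 0%N erefl) (z 1%N 1%N erefl).
have sumE (V : zmodType) (A1 A2 A3 A4 A5 : V) :
    0 + 0 + A1 + (0 + 0 + A2) + (A3 + A4 + A5) = A1 + A2 + A3 + A4 + A5.
  by rewrite !add0r !addrA.
exact: sumE.
Qed.

Lemma mul_ker_fullker n p m a b (F : R -> 'M[R]_(n, p)) (N : par1D R p m) theta :
  L2_on a b F -> L2_on a b (fun eta => N1 N eta theta) ->
  L2_on a b (fun eta => N2 N eta theta) ->
  mul_ker a b F N theta = F theta *m N0 N theta
    + mxint `[a, b] (fun eta => F eta *m fullker N eta theta).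
Proof.
move=> F2 N12 N22; rewrite mul_kerE -addrA; congr (_ + _).
have [m1 le1] := bounded_Phi_fst 1 theta.
have [m2 le2] := bounded_Phi_fst 2 theta.
have i1 := mx_integrableM_weight m1 le1 F2 N12.
have i2 := mx_integrableM_weight m2 le2 F2 N22.
rewrite -mxintD//; apply: eq_mxint => eta _.
by rewrite /fullker mulmxDr -!scalemxAr.
Qed.

Lemma ker_mul_fullker n p m a b (N : par1D R n p) (G : R -> 'M[R]_(p, m)) x :
  L2_on a b G -> L2_on a b (N1 N x) -> L2_on a b (N2 N x) ->
  ker_mul a b N G x = N0 N x *m G x
    + mxint `[a, b] (fun eta => fullker N x eta *m G eta).
Proof.
move=> G2 N12 N22; rewrite ker_mulE -addrA; congr (_ + _).
have [m1 le1] := bounded_Phi_snd 1 x.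
have [m2 le2] := bounded_Phi_snd 2 x.
have i1 := mx_integrableM_weight m1 le1 N12 G2.
have i2 := mx_integrableM_weight m2 le2 N22 G2.
rewrite -mxintD//; apply: eq_mxint => eta _.
by rewrite /fullker mulmxDl -!scalemxAl.
Qed.

(** The origin of the [Psi] table. Multiplying two full kernels gives four products of indicators
    under the integral. Above the diagonal ([x < theta]) the one of indices 1, 1 vanishes and the
    others simplify to the densities 212, 221, 222; below it the one of indices 2, 2 vanishes and
    111, 112, 121 remain. At [theta = x] the left side is 0 but the integral need not be. *)
Lemma fullker_ker_ker n p m a b (N : par1D R n p) (M : par1D R p m) x theta :
  theta != x -> L2_on a b (N1 N x) -> L2_on a b (N2 N x) ->
  L2_on a b (fun eta => N1 M eta theta) ->
  L2_on a b (fun eta => N2 M eta theta) ->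
  kI x theta *: ker_ker a b 1 N M x theta
    + kI theta x *: ker_ker a b 2 N M x theta =
  N0 N x *m fullker M x theta + fullker N x theta *m N0 M theta
    + mxint `[a, b] (fun eta => fullker N x eta *m fullker M eta theta).
Proof.
move=> neq N12 N22 M12 M22.
(* For concrete indices the [match] computes, so each instance below is the integrability of one
   weighted product. *)
have iP k i j (A : R -> 'M[R]_(n, p)) (B : R -> 'M[R]_(p, m)) :
    L2_on a b A -> L2_on a b B ->
    match Psi k i j x theta with
    | Delta _ => True
    | Density w => mx_integrable a b (fun eta => w eta *: (A eta *m B eta))
    end.
  have := bounded_Psi k i j x theta; case: Psi => // w [mw w1].
  exact: mx_integrableM_weight.
rewrite /fullker ker_ker1E ker_ker2E.
have [xt|tx] : x < theta \/ theta < x.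
  by move: neq; rewrite neq_lt => /orP[]; [right|left].
- have [-> ->] : kI x theta = 0 /\ kI theta x = 1.
    by rewrite /kI xt ltNge (ltW xt).
  rewrite !scale0r !scale1r !add0r -!addrA; congr (_ + _).
  rewrite addrCA; congr (_ + _).
  have i1 := iP 2%N 1%N 2%N _ _ N12 M22.
  have i2 := iP 2%N 2%N 1%N _ _ N22 M12.
  have i3 := iP 2%N 2%N 2%N _ _ N22 M22.
  rewrite -mxintD// -mxintD//; last exact: mx_integrableD.
  apply: eq_mxint => eta _.
  rewrite mulmxDl !mulmxDr -!scalemxAl -!scalemxAr !scalerA.
  (* A point [eta] with [theta < eta < x] would contradict [x < theta]. *)
  have -> : kI x eta * kI eta theta = 0 :> R.
    rewrite /kI -natrM mulnb.
    case: ltP => //= ex; case: ltP => // te.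
    by have := lt_trans (lt_trans te ex) xt; rewrite ltxx.
  have -> : kI x eta * kI theta eta = kI x eta :> R.
    rewrite /kI -natrM mulnb.
    by case: ltP => //= ex; rewrite (lt_trans ex xt).
  have -> : kI eta x * kI eta theta = kI eta theta :> R.
    rewrite /kI -natrM mulnb andbC.
    by case: ltP => //= te; rewrite (lt_trans xt te).
  have -> : kI eta x * kI theta eta = kH theta eta x :> R.
    by rewrite /kI /kH -natrM mulnb.
  by rewrite scale0r add0r.
- have [-> ->] : kI x theta = 1 /\ kI theta x = 0.
    by rewrite /kI tx ltNge (ltW tx).
  rewrite !scale0r !scale1r !addr0 -!addrA; congr (_ + _); congr (_ + _).
  have i1 := iP 1%N 1%N 1%N _ _ N12 M12.
  have i2 := iP 1%N 1%N 2%N _ _ N12 M22.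
  have i3 := iP 1%N 2%N 1%N _ _ N22 M12.
  rewrite -mxintD// -mxintD//; last exact: mx_integrableD.
  apply: eq_mxint => eta _.
  rewrite mulmxDl !mulmxDr -!scalemxAl -!scalemxAr !scalerA.
  have -> : kI x eta * kI eta theta = kH x eta theta :> R.
    by rewrite /kI /kH -natrM mulnb andbC.
  have -> : kI x eta * kI theta eta = kI theta eta :> R.
    rewrite /kI -natrM mulnb andbC.
    by case: ltP => //= et; rewrite (lt_trans et tx).
  have -> : kI eta x * kI eta theta = kI eta x :> R.
    rewrite /kI -natrM mulnb.
    by case: ltP => //= xe; rewrite (lt_trans tx xe).
  have -> : kI eta x * kI theta eta = 0 :> R.
    rewrite /kI -natrM mulnb.
    case: ltP => //= xe; case: ltP => // et.
    by have := lt_trans (lt_trans et tx) xe; rewrite ltxx.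
  by rewrite scale0r addr0 -!addrA.
Qed.

(** [mul_kerE] holds at every point, whereas merging its integrals into one with [fullker] needs L2
    columns; so the three terms are treated separately. The diagonal one is where the multiplier
    property enters. *)
Lemma L2_on2_mul_ker n p m a b c d (F : R -> R -> 'M[R]_(n, p))
    (N : par1D R p m) : L2_on2 c d a b F -> in_N1D a b N ->
  multiplier a b (N0 N) ->
  L2_on2 c d a b (fun y theta => mul_ker a b (F y) N theta).
Proof.
move=> F2 [_ N12 N22] multN.
rewrite (_ : (fun y theta => mul_ker a b (F y) N theta) =
    fun y theta => F y theta *m N0 N theta
  + mxint `[a, b] (fun eta => kI eta theta *: (F y eta *m N1 N eta theta))
  + mxint `[a, b] (fun eta => kI theta eta *: (F y eta *m N2 N eta theta)));
    last first.
  by apply/funext => y; apply/funext => theta; exact: mul_kerE.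
apply: L2_on2D; first apply: L2_on2D.
- exact: L2_on2_multr.
- apply: (L2_on2_comp_weight (w := fun x y z => kI y z)) => //.
    by apply: measurable_kI => //; apply: measurableT_comp.
  by move=> *; exact: norm_bool_le1.
- apply: (L2_on2_comp_weight (w := fun x y z => kI z y)) => //.
    by apply: measurable_kI => //; apply: measurableT_comp.
  by move=> *; exact: norm_bool_le1.
Qed.

Lemma L2_on_mul_ker n p m a b (F : R -> 'M[R]_(n, p)) (N : par1D R p m) :
  L2_on a b F -> in_N1D a b N -> multiplier a b (N0 N) ->
  L2_on a b (mul_ker a b F N).
Proof.
move=> F2 N2 multN; apply: (@L2_on_fst _ _ _ _ _ 0 1) => //.
apply: L2_on2_swap; apply: (@L2_on2_mul_ker _ _ _ _ _ _ _ (fun _ => F)) => //.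
exact: L2_on2_snd.
Qed.

Lemma L2_on2_ker_mul n p m a b c d (N : par1D R n p)
    (G : R -> R -> 'M[R]_(p, m)) : L2_on2 a b c d G -> in_N1D a b N ->
  multiplier a b (N0 N) ->
  L2_on2 a b c d (fun x nu => ker_mul a b N (fun eta => G eta nu) x).
Proof.
move=> G2 [_ N12 N22] multN.
rewrite (_ : (fun x nu => ker_mul a b N (fun eta => G eta nu) x) =
    fun x nu => N0 N x *m G x nu
  + mxint `[a, b] (fun eta => kI x eta *: (N1 N x eta *m G eta nu))
  + mxint `[a, b] (fun eta => kI eta x *: (N2 N x eta *m G eta nu)));
    last first.
  by apply/funext => x; apply/funext => nu; exact: ker_mulE.
apply: L2_on2D; first apply: L2_on2D.
- exact: L2_on2_multl.
- apply: (L2_on2_comp_weight (w := fun x y z => kI x y)) => //.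
    by apply: measurable_kI => //; apply: measurableT_comp.
  by move=> *; exact: norm_bool_le1.
- apply: (L2_on2_comp_weight (w := fun x y z => kI y x)) => //.
    by apply: measurable_kI => //; apply: measurableT_comp.
  by move=> *; exact: norm_bool_le1.
Qed.

Lemma L2_on_ker_mul n p m a b (N : par1D R n p) (G : R -> 'M[R]_(p, m)) :
  L2_on a b G -> in_N1D a b N -> multiplier a b (N0 N) ->
  L2_on a b (ker_mul a b N G).
Proof.
move=> G2 N2 multN; apply: (@L2_on_fst _ _ _ _ _ 0 1) => //.
apply: (@L2_on2_ker_mul _ _ _ _ _ _ _ _ (fun eta _ => G eta)) => //.
exact: L2_on2_fst.
Qed.

(** Of the five terms, two are products with a diagonal parameter, controlled by the multiplier
    property, and three are Hilbert-Schmidt compositions. For [k = 0] there is only the product of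
    the diagonal parameters, a function of one variable. *)
Lemma L2_on2_ker_ker n p m a b k (N : par1D R n p) (M : par1D R p m) :
  (k = 1 \/ k = 2)%N ->
  in_N1D a b N -> in_N1D a b M ->
  multiplier a b (N0 N) -> multiplier a b (N0 M) ->
  L2_on2 a b a b (ker_ker a b k N M).
Proof.
move=> k12 [_ N12 N22] [_ M12 M22] multN multM.
have m1 : measurable_fun setT (fun t : (R * R) * R => t.1.1).
  exact: measurableT_comp.
have m2 : measurable_fun setT (fun t : (R * R) * R => t.1.2).
  exact: measurableT_comp.
case: k12 => ->.
  rewrite (_ : ker_ker a b 1 N M = fun x theta => N0 N x *m N1 M x theta
  + N1 N x theta *m N0 M theta
  + mxint `[a, b] (fun eta => kH x eta theta *: (N1 N x eta *m N1 M eta theta))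
  + mxint `[a, b] (fun eta => kI theta eta *: (N1 N x eta *m N2 M eta theta))
  + mxint `[a, b] (fun eta => kI eta x *: (N2 N x eta *m N1 M eta theta)));
    last first.
    by apply/funext => x; apply/funext => theta; exact: ker_ker1E.
  apply: L2_on2D; first (apply: L2_on2D; first (apply: L2_on2D;
    first apply: L2_on2D)); [exact: L2_on2_multl|exact: L2_on2_multr|..].
  - apply: (L2_on2_comp_weight (w := fun x y z => kH x y z)) => //.
      exact: measurable_kH.
    by move=> *; exact: norm_bool_le1.
  - apply: (L2_on2_comp_weight (w := fun x y z => kI z y)) => //.
      exact: measurable_kI.
    by move=> *; exact: norm_bool_le1.
  - apply: (L2_on2_comp_weight (w := fun x y z => kI y x)) => //.
      exact: measurable_kI.
    by move=> *; exact: norm_bool_le1.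
rewrite (_ : ker_ker a b 2 N M = fun x theta => N0 N x *m N2 M x theta
  + mxint `[a, b] (fun eta => kI x eta *: (N1 N x eta *m N2 M eta theta))
  + N2 N x theta *m N0 M theta
  + mxint `[a, b] (fun eta => kI eta theta *: (N2 N x eta *m N1 M eta theta))
  + mxint `[a, b] (fun eta => kH theta eta x *: (N2 N x eta *m N2 M eta theta)));
    last first.
  by apply/funext => x; apply/funext => theta; exact: ker_ker2E.
apply: L2_on2D; first (apply: L2_on2D; first (apply: L2_on2D;
  first apply: L2_on2D)); [exact: L2_on2_multl| |exact: L2_on2_multr|..].
- apply: (L2_on2_comp_weight (w := fun x y z => kI x y)) => //.
    exact: measurable_kI.
  by move=> *; exact: norm_bool_le1.
- apply: (L2_on2_comp_weight (w := fun x y z => kI y z)) => //.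
    exact: measurable_kI.
  by move=> *; exact: norm_bool_le1.
- apply: (L2_on2_comp_weight (w := fun x y z => kH z y x)) => //.
    exact: measurable_kH.
  by move=> *; exact: norm_bool_le1.
Qed.

End kernel_products.

(** * 011-PI operators *)

(* Exchanging the roles of x and y maps the formulas for [R_01], [R_10],
   [R_12], [R_11] to those for [R_02], [R_20], [R_21], [R_22], so that only the
   former are studied below, by means of the [half_] predicates. *)
Section exchange.
Context (R : realType).
Implicit Types a b c d : R.

Definition swap011 n0 m0 n1 m1 (B : par011 R n0 m0 n1 m1) :=
  Par011 (B00 B) (B02 B) (B01 B) (B20 B) (B22 B) (B21 B) (B10 B) (B12 B)
    (B11 B).

Definition swap_state m0 m1 (u : state R m0 m1) := State (u0 u) (u2 u) (u1 u).

Definition half_N011 n0 m0 n1 m1 a b c d (B : par011 R n0 m0 n1 m1) :=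
  [/\ L2_on a b (B01 B), L2_on a b (B10 B), L2_on2 a b c d (B12 B)
    & in_N1D a b (B11 B)].

Definition half_eq_N011 n0 m0 n1 m1 a b c d (B B' : par011 R n0 m0 n1 m1) :=
  [/\ ae_eq (@lebesgue_measure R) [set` `[a, b]] (B01 B) (B01 B'),
      ae_eq (@lebesgue_measure R) [set` `[a, b]] (B10 B) (B10 B'),
      ae_eq (@lebesgue_measure R \x @lebesgue_measure R)%E
        ([set` `[a, b]] `*` [set` `[c, d]])
        (fun z => B12 B z.1 z.2) (fun z => B12 B' z.1 z.2)
    & eq_N1D a b (B11 B) (B11 B')].

Lemma in_N011_half n0 m0 n1 m1 a b c d (B : par011 R n0 m0 n1 m1) :
  in_N011 a b c d B <-> half_N011 a b c d B /\ half_N011 c d a b (swap011 B).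
Proof. by split=> [[[? ? ? ?] [? ? ? ?]]|[[? ? ? ?] [? ? ? ?]]]. Qed.

Lemma eq_N011_half n0 m0 n1 m1 a b c d (B B' : par011 R n0 m0 n1 m1) :
  eq_N011 a b c d B B' <->
  [/\ B00 B = B00 B', half_eq_N011 a b c d B B'
    & half_eq_N011 c d a b (swap011 B) (swap011 B')].
Proof. by split=> [[[? ? ? ? ?] [? ? ? ?]]|[? [? ? ? ?] [? ? ? ?]]]. Qed.

Lemma in_N011_swap n0 m0 n1 m1 a b c d (B : par011 R n0 m0 n1 m1) :
  in_N011 a b c d B -> in_N011 c d a b (swap011 B).
Proof. by case=> [[? ? ? ?] [? ? ? ?]]. Qed.

Lemma in_RL2_swap m0 m1 a b c d (u : state R m0 m1) :
  in_RL2 a b c d u -> in_RL2 c d a b (swap_state u).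
Proof. by case. Qed.

Lemma P011_swap n0 m0 n1 m1 a b c d (B : par011 R n0 m0 n1 m1)
    (u : state R m0 m1) :
  P011 c d a b (swap011 B) (swap_state u) = swap_state (P011 a b c d B u).
Proof.
rewrite /P011 /swap_state /=; congr State; first by rewrite addrAC.
- by apply/funext => y; rewrite addrAC.
- by apply/funext => x; rewrite addrAC.
Qed.

Lemma RL2_operator_swap n0 m0 n1 m1 a b c d (B : par011 R n0 m0 n1 m1) :
  RL2_operator a b c d B -> RL2_operator c d a b (swap011 B).
Proof.
move=> BL2 u u2; have -> : u = swap_state (swap_state u) by case: u {u2}.
by rewrite P011_swap; apply: in_RL2_swap; apply: BL2; exact: in_RL2_swap u2.
Qed.

Lemma L011_swap n0 p0 m0 n1 p1 m1 a b c d
    (B : par011 R n0 p0 n1 p1) (D : par011 R p0 m0 p1 m1) :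
  swap011 (L011 a b c d B D) = L011 c d a b (swap011 B) (swap011 D).
Proof.
rewrite /L011 /swap011 /=; congr Par011.
- by rewrite addrAC.
- by apply/funext => t; rewrite addrAC.
- by apply/funext => t; rewrite addrAC.
- by apply/funext => t; rewrite addrAC.
- by apply/funext => s; apply/funext => t; rewrite addrAC.
- by apply/funext => t; rewrite addrAC.
- by apply/funext => s; apply/funext => t; rewrite addrAC.
Qed.

End exchange.

(** * Diagonal multipliers and rows of 011-PI operators *)

Section operators.
Context (R : realType).
Implicit Types a b c d : R.
Local Notation mu := (@lebesgue_measure R).

Lemma L2_on_scale_delta m a b (g : R -> R) (j : 'I_m) :
  (fun s => chi a b s * g s) \in Lfun mu 2%:E ->
  L2_on a b (fun s => g s *: delta_mx j 0 : 'cV[R]_m).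
Proof.
move=> g2; apply/L2_onP => i k.
under eq_fun do rewrite !mxE mulrA mulrC.
exact: (Lfun2_scale _ g2).
Qed.

(** Apply the operator to [(0, g e_j, 0)]: the second component of the image is column [j] of the
    diagonal parameter times [g], plus an integral term. *)
Lemma RL2_multiplier n0 m0 n1 m1 a b c d (B : par011 R n0 m0 n1 m1) :
  in_N011 a b c d B -> RL2_operator a b c d B ->
  multiplier a b (N0 (B11 B)).
Proof.
move=> [[_ _ B10_2 _] [_ _ [N02 N12 N22] _]] BL2 i j g g2.
pose v s := g s *: delta_mx j 0 : 'cV[R]_m1.
have v2 : L2_on a b v by exact: L2_on_scale_delta.
pose u := State (0 : 'cV[R]_m0) v (fun=> 0).
have u2 : in_RL2 a b c d u by split=> //; exact: L2_on_cst.
have [Bu _] := BL2 u u2.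
(* The integral part alone. Its value at [v] is L2 because its kernels are, so subtracting it
   isolates the multiplication. *)
pose N' := Par1D (fun=> 0) (N1 (B11 B)) (N2 (B11 B)).
have PN' : L2_on a b (P1D a b N' v).
  apply: L2_on_P1D => //=.
  by under eq_fun do rewrite mul0mx; exact: L2_on_cst.
have : L2_on a b (fun s => N0 (B11 B) s *m v s).
  rewrite (_ : (fun s => _) = fun s =>
      u1 (P011 a b c d B u) s + (-1) *: P1D a b N' v s); last first.
    apply/funext => s /=; rewrite mulmx0 add0r.
    rewrite (_ : mxint _ _ = 0); last first.
      under [X in mxint _ X]eq_fun do rewrite mulmx0 -(scale0r 0).
      exact: mxint_scale0.
    by rewrite addr0 /P1D /= mul0mx add0r scaleN1r -(addrA (_ *m v s)) addrK.
  by apply: L2_onD => //; exact: L2_onZ.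
move=> /L2_onP/(_ i 0); under eq_fun do
  rewrite -scalemxAr mxE -colE mxE (mulrC (g _)).
by [].
Qed.

Section half.
Context (n0 p0 m0 n1 p1 m1 : nat) (a b c d : R).
Variables (B : par011 R n0 p0 n1 p1) (D : par011 R p0 m0 p1 m1).
Hypotheses (B2 : in_N011 a b c d B) (D2 : in_N011 a b c d D).
Hypothesis mB11 : multiplier a b (N0 (B11 B)).
Hypothesis mD11 : multiplier a b (N0 (B11 D)).
Hypothesis mD22 : multiplier c d (N0 (B22 D)).

Lemma half_L011 : half_N011 a b c d (L011 a b c d B D).
Proof.
have [[B01_2 B02_2 B10_2 B20_2] [B12_2 B21_2 B11_2 B22_2]] := B2.
have [[D01_2 D02_2 D10_2 D20_2] [D12_2 D21_2 D11_2 D22_2]] := D2.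
have k12 k : (k = 1 \/ k = 2)%N ->
    L2_on2 a b a b (R11_formula a b c d B D k).
  move=> kE; apply: L2_on2D; first exact: L2_on2_ker_ker.
  apply: L2_on2Z; apply: L2_on2D; first exact: L2_on2_tensor.
  exact: L2_on2_comp.
split=> /=.
- apply: L2_onD; first (apply: L2_onD; first exact: L2_on_mull).
    exact: L2_on_mul_ker.
  exact: L2_on_comp_l.
- apply: L2_onD; first (apply: L2_onD; first exact: L2_on_mulr).
    exact: L2_on_ker_mul.
  exact: L2_on_comp_r.
- apply: L2_on2D; first (apply: L2_on2D; first exact: L2_on2_tensor).
    exact: L2_on2_ker_mul.
  exact: L2_on2_mul_ker.
- split=> /=; [|by apply: k12; left|by apply: k12; right].
  rewrite (_ : (fun x => _) = fun x => N0 (B11 B) x *m N0 (B11 D) x).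
    by apply: multiplier_L2; exact: multiplierM.
  apply/funext => x; rewrite /R11_formula ker_ker0E.
  by rewrite /eps eqxx scale0r addr0.
Qed.

End half.

Lemma half_RL2 n0 m0 n1 m1 a b c d (Q : par011 R n0 m0 n1 m1)
    (u : state R m0 m1) :
  half_N011 a b c d Q -> multiplier a b (N0 (B11 Q)) -> in_RL2 a b c d u ->
  L2_on a b (u1 (P011 a b c d Q u)).
Proof.
move=> [_ Q10 Q12 [_ N12 N22]] mQ [u1_2 u2_2] /=.
apply: L2_onD; last exact: L2_on_comp_r.
apply: L2_onD; first exact: L2_on_mulr.
by apply: L2_on_P1D => //; exact: L2_on_multl.
Qed.

Lemma RL2_operator_of_multiplier n0 m0 n1 m1 a b c d
    (Q : par011 R n0 m0 n1 m1) : in_N011 a b c d Q ->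
  multiplier a b (N0 (B11 Q)) -> multiplier c d (N0 (B22 Q)) ->
  RL2_operator a b c d Q.
Proof.
move=> /in_N011_half[h1 h2] m1' m2' u u2; split; first exact: half_RL2.
have := half_RL2 (u := swap_state u) h2 m2' (in_RL2_swap u2).
by rewrite P011_swap.
Qed.

(* One row of a 011-PI operator, the diagonal multiplication left out.  With
   [k1 = B01 B] it is the first component of [P011], and with [k1] the full
   kernel of [B11 B] at a fixed point it is the rest of the second one, so a
   single composition lemma serves both components. *)
Definition rowop n p0 p1 a b c d (b0 : 'M[R]_(n, p0))
    (k1 k2 : R -> 'M[R]_(n, p1)) (w : state R p0 p1) :=
  b0 *m u0 w + mxint `[a, b] (fun x => k1 x *m u1 w x)
             + mxint `[c, d] (fun y => k2 y *m u2 w y).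

Lemma mulmx_rowop q n p0 p1 a b c d (A : 'M[R]_(q, n)) (b0 : 'M[R]_(n, p0))
    (k1 k2 : R -> 'M[R]_(n, p1)) (w : state R p0 p1) :
  L2_on a b k1 -> L2_on c d k2 -> in_RL2 a b c d w ->
  A *m rowop a b c d b0 k1 k2 w =
  rowop a b c d (A *m b0) (fun x => A *m k1 x) (fun y => A *m k2 y) w.
Proof.
move=> k1_2 k2_2 [w1 w2]; rewrite /rowop !mulmxDr mulmxA.
rewrite -mxint_mull; last exact: mx_integrableM.
rewrite -mxint_mull; last exact: mx_integrableM.
congr (_ + _ + _); apply: eq_mxint => s _; exact: mulmxA.
Qed.

Lemma rowopD n p0 p1 a b c d (b0 b0' : 'M[R]_(n, p0))
    (k1 k2 k1' k2' : R -> 'M[R]_(n, p1)) (w : state R p0 p1) :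
  L2_on a b k1 -> L2_on c d k2 -> L2_on a b k1' -> L2_on c d k2' ->
  in_RL2 a b c d w ->
  rowop a b c d b0 k1 k2 w + rowop a b c d b0' k1' k2' w =
  rowop a b c d (b0 + b0') (fun x => k1 x + k1' x) (fun y => k2 y + k2' y) w.
Proof.
move=> k1_2 k2_2 k1'2 k2'2 [w1 w2]; rewrite /rowop.
rewrite addrACA [X in X + _]addrACA -mulmxDl -!mxintD; try exact: mx_integrableM.
by congr (_ + _ + _); apply: eq_mxint => s _; rewrite mulmxDl.
Qed.

Lemma ae_eq_rowop n p0 p1 a b c d (b0 : 'M[R]_(n, p0))
    (k1 k2 k1' k2' : R -> 'M[R]_(n, p1)) (w : state R p0 p1) :
  L2_on a b k1 -> L2_on c d k2 -> L2_on a b k1' -> L2_on c d k2' ->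
  {ae mu, forall x, x \in `[a, b] -> k1 x = k1' x} ->
  {ae mu, forall y, y \in `[c, d] -> k2 y = k2' y} ->
  in_RL2 a b c d w ->
  rowop a b c d b0 k1 k2 w = rowop a b c d b0 k1' k2' w.
Proof.
move=> k1_2 k2_2 k1'2 k2'2 kk1 kk2 [w1 w2]; rewrite /rowop.
congr (_ + _ + _); apply: ae_eq_mxint; try exact: mx_integrableM.
- by apply: ae_imply kk1 => s H /H ->.
- by apply: ae_imply kk2 => s H /H ->.
Qed.

Lemma P011_row n0 m0 n1 m1 a b c d (Q : par011 R n0 m0 n1 m1)
    (u : state R m0 m1) x : in_RL2 a b c d u -> x \in `[a, b] ->
  L2_on a b (N1 (B11 Q) x) -> L2_on a b (N2 (B11 Q) x) ->
  u1 (P011 a b c d Q u) x =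
  N0 (B11 Q) x *m u1 u x
  + rowop a b c d (B10 Q x) (fullker (B11 Q) x) (B12 Q x) u.
Proof.
move=> [u1_2 u2_2] xab N12 N22 /=; rewrite P1D_E// /rowop addrCA !addrA.
by rewrite addrAC.
Qed.

End operators.

(** * Composition *)

Section composition.
Context (R : realType).
Implicit Types a b c d : R.
Local Notation mu := (@lebesgue_measure R).

Lemma half_section n0 m0 n1 m1 a b c d (Q : par011 R n0 m0 n1 m1) :
  half_N011 a b c d Q -> {ae mu, forall x, x \in `[a, b] ->
    [/\ L2_on a b (N1 (B11 Q) x), L2_on a b (N2 (B11 Q) x),
        L2_on a b (fullker (B11 Q) x) & L2_on c d (B12 Q x)]}.
Proof.
move=> [_ _ Q12 QN]; have [_ N12 N22] := QN.
have F2 := L2_on2_fullker QN.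
have : {ae mu, forall x, x \in `[a, b] ->
    [/\ L2_on a b (N1 (B11 Q) x), L2_on a b (N2 (B11 Q) x)
      & L2_on a b (fullker (B11 Q) x)]}.
  apply: ae_imply3 (L2_on2_section N12) (L2_on2_section N22)
    (L2_on2_section F2) => x n1x n2x fx xab.
  by split; [exact: n1x|exact: n2x|exact: fx].
apply: ae_imply2 (L2_on2_section Q12) => x q12 H xab.
by have [? ? ?] := H xab; split=> //; exact: q12.
Qed.

Lemma N1D_section2 n m a b (N : par1D R n m) : in_N1D a b N ->
  {ae mu, forall theta, theta \in `[a, b] ->
    L2_on a b (fun eta => N1 N eta theta) /\
    L2_on a b (fun eta => N2 N eta theta)}.
Proof.
move=> [_ N12 N22]; apply: ae_imply2 (L2_on2_section (L2_on2_swap N12))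
  (L2_on2_section (L2_on2_swap N22)).
by move=> x n1 n2 xab; split; [exact: n1|exact: n2].
Qed.

Lemma rowop_swap n p0 p1 a b c d (b0 : 'M[R]_(n, p0))
    (k1 k2 : R -> 'M[R]_(n, p1)) (w : state R p0 p1) :
  rowop c d a b b0 k2 k1 (swap_state w) = rowop a b c d b0 k1 k2 w.
Proof. by rewrite /rowop addrAC. Qed.

(** A row [k] applied to the second component of P[D]u is again a row applied to [u]: the three
    inputs contribute separately, and Fubini carries [k] past the inner integrals. *)
Lemma mxint_P011 n n0 m0 n1 m1 a b c d (D : par011 R n0 m0 n1 m1)
    (u : state R m0 m1) (k : R -> 'M[R]_(n, n1)) :
  half_N011 a b c d D -> multiplier a b (N0 (B11 D)) -> in_RL2 a b c d u ->
  L2_on a b k ->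
  mxint `[a, b] (fun x => k x *m u1 (P011 a b c d D u) x) =
  rowop a b c d (mxint `[a, b] (fun x => k x *m B10 D x))
    (mul_ker a b k (B11 D))
    (fun nu => mxint `[a, b] (fun x => k x *m B12 D x nu)) u.
Proof.
move=> hD mD u_2 k2; have w2 := half_RL2 hD mD u_2.
have [u1_2 u2_2] := u_2; have [_ D10 D12 DN] := hD.
have F2 := L2_on2_fullker DN.
(* [mul_ker a b k (B11 D)] with its two triangular integrals merged, the form that Fubini produces.
   The two agree at almost every [theta]. *)
pose k1' theta := k theta *m N0 (B11 D) theta
  + mxint `[a, b] (fun eta => k eta *m fullker (B11 D) eta theta).
have kN2 : L2_on a b (fun x => k x *m N0 (B11 D) x) by exact: L2_on_multr.
have kF2 : L2_on a b
    (fun theta => mxint `[a, b] (fun eta => k eta *m fullker (B11 D) eta theta)).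
  exact: L2_on_comp_l.
have k1'2 : L2_on a b k1' by exact: L2_onD.
transitivity (rowop a b c d (mxint `[a, b] (fun x => k x *m B10 D x)) k1'
    (fun nu => mxint `[a, b] (fun x => k x *m B12 D x nu)) u); last first.
  apply: ae_eq_rowop => //.
  - exact: L2_on_comp_l.
  - exact: L2_on_mul_ker.
  - exact: L2_on_comp_l.
  - apply: ae_imply (N1D_section2 DN) => theta H tab.
    by have [? ?] := H tab; rewrite mul_ker_fullker.
  - exact: aeW.
have i1 := mx_integrableM k2 (L2_on_mulr (u0 u) D10).
have i2 := mx_integrableM k2 (L2_on_comp_r F2 u1_2).
have i3 := mx_integrableM k2 (L2_on_comp_r D12 u2_2).
have i0 := mx_integrableM kN2 u1_2.
have i01 := mx_integrableD i0 i1.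
have i012 := mx_integrableD i01 i2.
(* [P011_row] rewrites the second component at the points [x] whose rows are L2, which is enough
   under the integral. *)
transitivity (mxint `[a, b] (fun x => k x *m N0 (B11 D) x *m u1 u x
    + k x *m (B10 D x *m u0 u)
    + k x *m mxint `[a, b] (fun t => fullker (B11 D) x t *m u1 u t)
    + k x *m mxint `[c, d] (fun y => B12 D x y *m u2 u y))).
  apply: ae_eq_mxint; [exact: mx_integrableM|exact: mx_integrableD|].
  apply: ae_imply (half_section hD) => x H xab; have [? ? ? ?] := H xab.
  by rewrite P011_row// /rowop !mulmxDr !mulmxA !addrA.
rewrite (mxintD i012 i3) (mxintD i01 i2) (mxintD i0 i1).
rewrite (mxint_Fubini k2 F2 u1_2) (mxint_Fubini k2 D12 u2_2) /rowop.
have -> : mxint `[a, b] (fun theta => k1' theta *m u1 u theta) =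
    mxint `[a, b] (fun theta => k theta *m N0 (B11 D) theta *m u1 u theta)
    + mxint `[a, b] (fun theta => mxint `[a, b]
        (fun eta => k eta *m fullker (B11 D) eta theta) *m u1 u theta).
  rewrite -(mxintD i0 (mx_integrableM kF2 u1_2)); apply: eq_mxint => theta _.
  by rewrite mulmxDl.
rewrite -(mxint_mulr _ (mx_integrableM k2 D10)).
under [X in _ = mxint _ X + _ + _]eq_fun do rewrite -mulmxA.
by rewrite [in RHS]addrCA addrA.
Qed.

(** With [B00 B], [B01 B], [B02 B] for [b0], [k1], [k2], the new coefficients are literally those of
    R_00, R_01, R_02. *)
Lemma rowop_P011 n n0 m0 n1 m1 a b c d (D : par011 R n0 m0 n1 m1)
    (u : state R m0 m1) (b0 : 'M[R]_(n, n0)) (k1 k2 : R -> 'M[R]_(n, n1)) :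
  in_N011 a b c d D ->
  multiplier a b (N0 (B11 D)) -> multiplier c d (N0 (B22 D)) ->
  in_RL2 a b c d u -> L2_on a b k1 -> L2_on c d k2 ->
  rowop a b c d b0 k1 k2 (P011 a b c d D u) =
  rowop a b c d
    (b0 *m B00 D + mxint `[a, b] (fun eta => k1 eta *m B10 D eta)
      + mxint `[c, d] (fun y => k2 y *m B20 D y))
    (fun theta => b0 *m B01 D theta + mul_ker a b k1 (B11 D) theta
      + mxint `[c, d] (fun y => k2 y *m B21 D y theta))
    (fun nu => b0 *m B02 D nu
      + mxint `[a, b] (fun eta => k1 eta *m B12 D eta nu)
      + mul_ker c d k2 (B22 D) nu) u.
Proof.
move=> D2 mD11 mD22 u_2 k1_2 k2_2.
have [hD hD'] := (in_N011_half _ _ _ _ _).1 D2.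
have [D01 D10 D12 D11] := hD; have [D02 D20 D21 D22] := hD'.
rewrite {1}/rowop (mxint_P011 hD mD11 u_2 k1_2).
(* The contribution of the third component, by exchanging the variables. *)
have := mxint_P011 hD' mD22 (in_RL2_swap u_2) k2_2.
rewrite P011_swap rowop_swap /= => ->.
rewrite -[X in b0 *m X]/(rowop a b c d (B00 D) (B01 D) (B02 D) u).
rewrite (mulmx_rowop b0 _ D01 D02 u_2).
have b1 := L2_on_mull b0 D01; have b2 := L2_on_mull b0 D02.
have mk1 := L2_on_mul_ker k1_2 D11 mD11; have c1 := L2_on_comp_l k1_2 D12.
have mk2 := L2_on_mul_ker k2_2 D22 mD22; have c2 := L2_on_comp_l k2_2 D21.
rewrite (rowopD _ _ b1 b2 mk1 c1 u_2).
by rewrite (rowopD _ _ (L2_onD b1 mk1) (L2_onD b2 c1) c2 mk2 u_2).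
Qed.

Section composition_L011.
Context (n0 p0 m0 n1 p1 m1 : nat) (a b c d : R).
Variables (B : par011 R n0 p0 n1 p1) (D : par011 R p0 m0 p1 m1).
Hypotheses (B2 : in_N011 a b c d B) (D2 : in_N011 a b c d D).
Hypothesis mB11 : multiplier a b (N0 (B11 B)).
Hypothesis mD11 : multiplier a b (N0 (B11 D)).
Hypothesis mD22 : multiplier c d (N0 (B22 D)).
Variable u : state R m0 m1.
Hypothesis u_2 : in_RL2 a b c d u.

Lemma u0_P011_L011 :
  u0 (P011 a b c d B (P011 a b c d D u)) = u0 (P011 a b c d (L011 a b c d B D) u).
Proof.
have [[B01_2 B02_2 _ _] _] := B2.
exact: (rowop_P011 (B00 B) D2 mD11 mD22 u_2 B01_2 B02_2).
Qed.

Lemma fullker_L011 x theta : theta != x ->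
  L2_on a b (N1 (B11 B) x) -> L2_on a b (N2 (B11 B) x) ->
  L2_on a b (fullker (B11 B) x) ->
  L2_on a b (fun eta => N1 (B11 D) eta theta) ->
  L2_on a b (fun eta => N2 (B11 D) eta theta) ->
  fullker (B11 (L011 a b c d B D)) x theta =
  N0 (B11 B) x *m fullker (B11 D) x theta
  + (B10 B x *m B01 D theta + mul_ker a b (fullker (B11 B) x) (B11 D) theta
    + mxint `[c, d] (fun y => B12 B x y *m B21 D y theta)).
Proof.
move=> tx bx1 bx2 bxf dt1 dt2; rewrite {1}/fullker /=.
rewrite /R11_formula (scalerDr (kI x theta)) (scalerDr (kI theta x)) addrACA.
rewrite fullker_ker_ker// !scalerA -scalerDl.
(* Off the diagonal exactly one indicator is 1, so the bracket multiplied by [eps], common to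
   [k = 1] and [k = 2], is counted once. *)
have -> : kI x theta * eps R 1 + kI theta x * eps R 2 = 1.
  rewrite /eps /kI !mulr1 -natrD.
  by move: tx; rewrite neq_lt => /orP[] tx; rewrite tx ltNge (ltW tx).
rewrite scale1r mul_ker_fullker// -!addrA; congr (_ + _).
by rewrite [RHS]addrCA; congr (_ + _); rewrite [RHS]addrCA.
Qed.

(** Fix an [x] whose rows are L2. The outer operator is then a multiplication plus a row:
    [rowop_P011] composes the row with P[D], the multiplication turns row [x] of P[D] into another
    row, and the sum of the two is row [x] of [L011], up to null sets in the remaining variable. *)
Lemma u1_P011_L011 : in_RL2 a b c d (P011 a b c d D u) ->
  in_N011 a b c d (L011 a b c d B D) ->
  ae_eq mu [set` `[a, b]] (u1 (P011 a b c d B (P011 a b c d D u)))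
    (u1 (P011 a b c d (L011 a b c d B D) u)).
Proof.
move=> w_2 L2.
have [hB _] := (in_N011_half _ _ _ _ _).1 B2.
have [hD hD'] := (in_N011_half _ _ _ _ _).1 D2.
have [hL _] := (in_N011_half _ _ _ _ _).1 L2.
have [D01 D10 D12 D11] := hD; have [D02 D20 D21 D22] := hD'.
apply: ae_imply3 (half_section hB) (half_section hD) (half_section hL).
move=> x HB HD HL xab.
have [bx1 bx2 bxf bx12] := HB xab.
have [dx1 dx2 dxf dx12] := HD xab.
have [lx1 lx2 lxf lx12] := HL xab.
rewrite P011_row// (rowop_P011 (B10 B x) D2 mD11 mD22 u_2 bxf bx12).
rewrite P011_row// mulmxDr mulmxA -addrA [RHS]P011_row//.
have -> : N0 (B11 (L011 a b c d B D)) x = N0 (B11 B) x *m N0 (B11 D) x.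
  by rewrite /= /R11_formula ker_ker0E /eps eqxx scale0r addr0.
congr (_ + _); rewrite mulmx_rowop// rowopD//; last 4 first.
- exact: L2_on_mull.
- exact: L2_on_mull.
- by apply: L2_onD; [apply: L2_onD; [exact: L2_on_mull|exact: L2_on_mul_ker]
    |exact: L2_on_comp_l].
- by apply: L2_onD; [apply: L2_onD; [exact: L2_on_mull|exact: L2_on_comp_l]
    |exact: L2_on_mul_ker].
have -> : B10 (L011 a b c d B D) x = N0 (B11 B) x *m B10 D x +
    (B10 B x *m B00 D
     + mxint `[a, b] (fun eta => fullker (B11 B) x eta *m B10 D eta)
     + mxint `[c, d] (fun y => B12 B x y *m B20 D y)).
  by rewrite /= ker_mul_fullker// [in RHS]addrA [in RHS]addrA addrCA !addrA.
apply: ae_eq_rowop => //.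
- apply: L2_onD; first exact: L2_on_mull.
  by apply: L2_onD; [apply: L2_onD; [exact: L2_on_mull|exact: L2_on_mul_ker]
    |exact: L2_on_comp_l].
- apply: L2_onD; first exact: L2_on_mull.
  by apply: L2_onD; [apply: L2_onD; [exact: L2_on_mull|exact: L2_on_comp_l]
    |exact: L2_on_mul_ker].
(* At [theta = x] the two kernels may differ, since [fullker] is 0 there. *)
- apply: ae_imply2 (ae_neq x) (N1D_section2 D11) => theta tx H tab.
  by have [dt1 dt2] := H tab; rewrite fullker_L011.
- apply: ae_imply (L2_on2_section (L2_on2_swap D12)) => nu H nucd.
  rewrite /= ker_mul_fullker//; last exact: H.
  by rewrite !addrA; congr (_ + _ + _); rewrite addrC.
Qed.

End composition_L011.
End composition.

(** * Uniqueness *)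

Section uniqueness.
Context (R : realType).
Implicit Types a b c d : R.
Local Notation mu := (@lebesgue_measure R).

Lemma Rintegral_indic_chi (E : set R) c d (k : R -> R) :
  \int[mu]_(y in E) (chi c d y * k y) =
  \int[mu]_y (chi c d y * (k y * \1_E y)).
Proof.
rewrite Rintegral_mkcond; apply: eq_Rintegral => y _.
by rewrite patchE indicE; case: ifPn => _; rewrite ?mulr1 ?mulr0.
Qed.

Lemma Lfun2_chi_indic (E : set R) c d : measurable E ->
  (fun s => chi c d s * \1_E s) \in Lfun mu 2%:E.
Proof.
move=> mE; under eq_fun do rewrite mulrC.
apply: Lfun2_weight; [exact: measurable_indic| |exact: Lfun2_chi].
by move=> x; rewrite indicE; exact: norm_bool_le1.
Qed.

Lemma measurable_rational_ray (E : set R) : rational_rays E -> measurable E.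
Proof. by move=> [q _ <-]; exact: measurable_itv. Qed.

Lemma ae_eq0_of_integrals c d (k : R -> R) :
  (fun y => chi c d y * k y) \in Lfun mu 2%:E ->
  (forall g, (fun y => chi c d y * g y) \in Lfun mu 2%:E ->
    \int[mu]_y (chi c d y * (k y * g y)) = 0) ->
  {ae mu, forall y, y \in `[c, d] -> k y = 0}.
Proof.
move=> k2 k0.
have ik : mu.-integrable setT (EFin \o (fun y => chi c d y * k y)).
  have := Lfun2_integrableM (Lfun2_chi c d) k2.
  by under eq_fun do rewrite mulrA chi_idem.
(* There is no multiplication term, so any point will do for [x]. *)
have [||_] := eq0_of_rational_rays (x := 0) (n0 := 0) ik.
- rewrite add0r Rintegral_indic_chi; apply: k0.
  exact: Lfun2_chi_indic measurableT.
- move=> E rE; rewrite mul0r add0r Rintegral_indic_chi; apply: k0.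
  by apply: Lfun2_chi_indic; exact: measurable_rational_ray.
by apply: ae_imply => y + ycd; rewrite chi1// mul1r.
Qed.

(** Indicators of rays become L2 by truncation to [[c, d]]. With the kernel extended by 0 off the
    rectangle, testing against a truncated ray is integrating over the whole ray. *)
Lemma ae_eq0_of_operator a b c d (n : R -> R) (K : R * R -> R) :
  (fun z => chi a b z.1 * chi c d z.2 * K z) \in Lfun (mu \x mu)%E 2%:E ->
  (forall g, (fun y => chi c d y * g y) \in Lfun mu 2%:E ->
    {ae mu, forall x, x \in `[a, b] ->
      n x * g x + \int[mu]_y (chi c d y * (K (x, y) * g y)) = 0}) ->
  {ae mu, forall x, x \in `[a, b] -> n x = 0} /\
  {ae (mu \x mu)%E, forall z, z.1 \in `[a, b] -> z.2 \in `[c, d] -> K z = 0}.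
Proof.
move=> K2 K0.
have intE (E : set R) x : x \in `[a, b] ->
    \int[mu]_(y in E) (chi a b x * chi c d y * K (x, y)) =
    \int[mu]_y (chi c d y * (K (x, y) * \1_E y)).
  move=> xab; rewrite -Rintegral_indic_chi; apply: eq_Rintegral => y _.
  by rewrite (chi1 xab) mul1r.
have [||||n0 Kz0] := eq0_of_section_integrals (A := [set` `[a, b]]) (n := n) K2.
- have S := Lfun2_section K2; apply: ae_imply S => x Kx.
  have := Lfun2_integrableM (Lfun2_chi c d) Kx => /=.
  apply: eq_integrable => // y _ /=; congr EFin.
  by rewrite -[in RHS](chi_idem c d); ring.
- have := K0 (\1_setT) (Lfun2_chi_indic _ _ measurableT).
  by apply: ae_imply => x H xab; rewrite intE// -[RHS](H xab) indicT mulr1.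
- move=> E rE; have mE := measurable_rational_ray rE.
  have := K0 (\1_E) (Lfun2_chi_indic _ _ mE).
  by apply: ae_imply => x H xab; rewrite intE// -[RHS](H xab).
- by move=> x y /negP xab; rewrite chi0// !mul0r.
split=> //; apply: ae_imply Kz0 => z + z1 z2.
by rewrite (chi1 z1) (chi1 z2) !mul1r.
Qed.

End uniqueness.

(** * Recovering the parameters from the operator *)

Section uniqueness_N011.
Context (R : realType).
Implicit Types a b c d : R.
Local Notation mu := (@lebesgue_measure R).

Lemma mulmx_scale_delta n m (A : 'M[R]_(n, m)) (t : R) j i :
  (A *m (t *: delta_mx j 0 : 'cV[R]_m)) i 0 = A i j * t.
Proof. by rewrite -scalemxAr mxE -colE mxE mulrC. Qed.

Lemma mxint_mulmx0 n m a b (F : R -> 'M[R]_(n, m)) :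
  mxint `[a, b] (fun s => F s *m (0 : 'cV[R]_m)) = 0.
Proof.
by under [X in mxint _ X]eq_fun do rewrite mulmx0 -(scale0r 0);
  exact: mxint_scale0.
Qed.

(** Three families of test states: the constant [e0 j] reads off column [j] of [B00] and [B10];
    [e1 g j] determines [B01] through the first component and, through the second, the diagonal
    multiplication together with the full kernel of [B11]; [e2 g j] determines [B12]. *)
Lemma half_unique n0 m0 n1 m1 a b c d (Q Q' : par011 R n0 m0 n1 m1) :
  in_N011 a b c d Q -> in_N011 a b c d Q' ->
  (forall u, in_RL2 a b c d u ->
    u0 (P011 a b c d Q u) = u0 (P011 a b c d Q' u) /\
    ae_eq mu [set` `[a, b]] (u1 (P011 a b c d Q u)) (u1 (P011 a b c d Q' u))) ->
  B00 Q = B00 Q' /\ half_eq_N011 a b c d Q Q'.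
Proof.
move=> /in_N011_half[hQ _] /in_N011_half[hQ' _] QQ'.
have [Q01 Q10 Q12 QN] := hQ; have [Q01' Q10' Q12' QN'] := hQ'.
pose e0 (j : 'I_m0) := State (delta_mx j 0 : 'cV[R]_m0)
  (fun=> 0 : 'cV[R]_m1) (fun=> 0 : 'cV[R]_m1).
pose e1 (g : R -> R) (j : 'I_m1) := State (0 : 'cV[R]_m0)
  (fun s => g s *: delta_mx j 0 : 'cV[R]_m1) (fun=> 0 : 'cV[R]_m1).
pose e2 (g : R -> R) (j : 'I_m1) := State (0 : 'cV[R]_m0)
  (fun=> 0 : 'cV[R]_m1) (fun s => g s *: delta_mx j 0 : 'cV[R]_m1).
have e0_2 j : in_RL2 a b c d (e0 j) by split; exact: L2_on_cst.
have e1_2 g j : (fun y => chi a b y * g y) \in Lfun mu 2%:E ->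
    in_RL2 a b c d (e1 g j).
  by move=> g2; split; [exact: L2_on_scale_delta|exact: L2_on_cst].
have e2_2 g j : (fun y => chi c d y * g y) \in Lfun mu 2%:E ->
    in_RL2 a b c d (e2 g j).
  by move=> g2; split; [exact: L2_on_cst|exact: L2_on_scale_delta].
have row0 (P : par011 R n0 m0 n1 m1) j i :
    u0 (P011 a b c d P (e0 j)) i 0 = B00 P i j.
  by rewrite /= !mxint_mulmx0 !addr0 -colE mxE.
have row1 (P : par011 R n0 m0 n1 m1) g j i : u0 (P011 a b c d P (e1 g j)) i 0 =
    \int[mu]_y (chi a b y * (B01 P y i j * g y)).
  rewrite /= mxint_mulmx0 mulmx0 add0r addr0 mxintE.
  by apply: eq_Rintegral => y _; rewrite mulmx_scale_delta.
have col0 (P : par011 R n0 m0 n1 m1) j x i : half_N011 a b c d P ->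
    x \in `[a, b] -> L2_on a b (N1 (B11 P) x) -> L2_on a b (N2 (B11 P) x) ->
    u1 (P011 a b c d P (e0 j)) x i 0 = B10 P x i j.
  move=> hP xab P1 P2; rewrite P011_row// /rowop /= mulmx0 add0r.
  by rewrite !mxint_mulmx0 !addr0 -colE mxE.
have col1 (P : par011 R n0 m0 n1 m1) g j x i : half_N011 a b c d P ->
    (fun y => chi a b y * g y) \in Lfun mu 2%:E ->
    x \in `[a, b] -> L2_on a b (N1 (B11 P) x) -> L2_on a b (N2 (B11 P) x) ->
    u1 (P011 a b c d P (e1 g j)) x i 0 = N0 (B11 P) x i j * g x +
    \int[mu]_y (chi a b y * (fullker (B11 P) x y i j * g y)).
  move=> hP g2 xab P1 P2; rewrite P011_row//; last exact: e1_2.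
  rewrite /rowop /= mulmx0 add0r mxint_mulmx0 addr0 mxE mulmx_scale_delta.
  congr (_ + _); rewrite mxintE.
  by apply: eq_Rintegral => y _; rewrite mulmx_scale_delta.
have col2 (P : par011 R n0 m0 n1 m1) g j x i : half_N011 a b c d P ->
    (fun y => chi c d y * g y) \in Lfun mu 2%:E ->
    x \in `[a, b] -> L2_on a b (N1 (B11 P) x) -> L2_on a b (N2 (B11 P) x) ->
    u1 (P011 a b c d P (e2 g j)) x i 0 =
    \int[mu]_y (chi c d y * (B12 P x y i j * g y)).
  move=> hP g2 xab P1 P2; rewrite P011_row//; last exact: e2_2.
  rewrite /rowop /= !mulmx0 !add0r mxint_mulmx0 add0r mxintE.
  by apply: eq_Rintegral => y _; rewrite mulmx_scale_delta.
have sub_int e f (k k' g : R -> R) :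
    mu.-integrable setT (fun y => (chi e f y * (k y * g y))%:E) ->
    mu.-integrable setT (fun y => (chi e f y * (k' y * g y))%:E) ->
    \int[mu]_y (chi e f y * ((k y - k' y) * g y)) =
    \int[mu]_y (chi e f y * (k y * g y)) - \int[mu]_y (chi e f y * (k' y * g y)).
  move=> ik ik'; rewrite -RintegralB//; apply: eq_Rintegral => y _; ring.
have int_sec e f n m (F : R -> 'M[R]_(n, m)) i j (g : R -> R) :
    L2_on e f F -> (fun y => chi e f y * g y) \in Lfun mu 2%:E ->
    mu.-integrable setT (fun y => (chi e f y * (F y i j * g y))%:E).
  move=> /L2_onP/(_ i j) F2 g2.
  have := Lfun2_integrableM F2 g2; apply: eq_integrable => // y _ /=.
  by congr EFin; rewrite -[in RHS](chi_idem e f); ring.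
have subL2 (e f : R) n m (F F' : R -> 'M[R]_(n, m)) i j :
    L2_on e f F -> L2_on e f F' ->
    (fun y => chi e f y * (F y i j - F' y i j)) \in Lfun mu 2%:E.
  move=> F2 F'2; have /L2_onP/(_ i j) := L2_onD F2 (L2_onZ (-1) F'2).
  by under eq_fun do rewrite !mxE mulN1r.
have subL22 (e f e' f' : R) n m (F F' : R -> R -> 'M[R]_(n, m)) i j :
    L2_on2 e f e' f' F -> L2_on2 e f e' f' F' ->
    (fun z => chi e f z.1 * chi e' f' z.2 * (F z.1 z.2 i j - F' z.1 z.2 i j))
      \in Lfun (mu \x mu)%E 2%:E.
  move=> F2 F'2; have /L2_on2P/(_ i j) := L2_on2D F2 (L2_on2Z (-1) F'2).
  by under eq_fun do rewrite !mxE mulN1r.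
have sec := half_section hQ; have sec' := half_section hQ'.
split.
  apply/matrixP => i j; rewrite -!row0.
  by have [-> _] := QQ' _ (e0_2 j).
(* The test states see the multiplication and the integral term only through their sum, so both
   differences must be shown to vanish at once. *)
have diag i j : {ae mu, forall x, x \in `[a, b] ->
      N0 (B11 Q) x i j - N0 (B11 Q') x i j = 0} /\
    {ae (mu \x mu)%E, forall z, z.1 \in `[a, b] -> z.2 \in `[a, b] ->
      fullker (B11 Q) z.1 z.2 i j - fullker (B11 Q') z.1 z.2 i j = 0}.
  apply: (ae_eq0_of_operator (a := a) (b := b) (c := a) (d := b)
    (n := fun x => N0 (B11 Q) x i j - N0 (B11 Q') x i j)
    (K := fun z => fullker (B11 Q) z.1 z.2 i j - fullker (B11 Q') z.1 z.2 i j)).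
    by apply: subL22; exact: L2_on2_fullker.
  move=> g g2; have [_ QQg] := QQ' _ (e1_2 g j g2).
  apply: ae_imply3 QQg sec sec' => x QQx s s' xab.
  have [s1 s2 sf _] := s xab; have [s1' s2' sf' _] := s' xab.
  have := congr1 (fun A : 'cV[R]_n1 => A i 0) (QQx xab).
  rewrite col1// col1// sub_int; [|exact: int_sec|exact: int_sec].
  by move=> H; rewrite mulrBl addrACA -opprD H subrr.
(* The same criterion with a zero multiplication term. *)
have off i j :
    {ae (mu \x mu)%E, forall z, z.1 \in `[a, b] -> z.2 \in `[c, d] ->
      B12 Q z.1 z.2 i j - B12 Q' z.1 z.2 i j = 0}.
  apply: (ae_eq0_of_operator (a := a) (b := b) (c := c) (d := d) (n := fun=> 0)
    (K := fun z => B12 Q z.1 z.2 i j - B12 Q' z.1 z.2 i j) _ _).2.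
    exact: subL22.
  move=> g g2; have [_ QQg] := QQ' _ (e2_2 g j g2).
  apply: ae_imply3 QQg sec sec' => x QQx s s' xab.
  have [s1 s2 _ sf] := s xab; have [s1' s2' _ sf'] := s' xab.
  have := congr1 (fun A : 'cV[R]_n1 => A i 0) (QQx xab).
  rewrite col2// col2// sub_int; [|exact: int_sec|exact: int_sec].
  by move=> ->; rewrite mul0r add0r subrr.
have fullE : {ae (mu \x mu)%E, forall z, z.1 \in `[a, b] -> z.2 \in `[a, b] ->
    fullker (B11 Q) z.1 z.2 = fullker (B11 Q') z.1 z.2}.
  have := ae_forall_fin (fun i => ae_forall_fin (fun j => (diag i j).2)).
  apply: ae_imply => z H z1 z2; apply/matrixP => i j.
  by apply/eqP; rewrite -subr_eq0 H.
split.
- have E i j : {ae mu, forall y, y \in `[a, b] -> B01 Q y i j - B01 Q' y i j = 0}.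
    apply: ae_eq0_of_integrals; first exact: subL2.
    move=> g g2; rewrite sub_int; [|exact: int_sec|exact: int_sec].
    by rewrite -!row1; have [-> _] := QQ' _ (e1_2 g j g2); rewrite subrr.
  apply: ae_imply (ae_forall_fin (fun i => ae_forall_fin (E i))) => x H xab.
  by apply/matrixP => i j; apply/eqP; rewrite -subr_eq0 H.
- have E j : {ae mu, forall x, x \in `[a, b] ->
      forall i, B10 Q x i j = B10 Q' x i j}.
    have [_ QQj] := QQ' _ (e0_2 j).
    apply: ae_imply3 QQj sec sec' => x QQx s s' xab i.
    have [s1 s2 _ _] := s xab; have [s1' s2' _ _] := s' xab.
    by have := congr1 (fun A : 'cV[R]_n1 => A i 0) (QQx xab); rewrite col0// col0.
  apply: ae_imply (ae_forall_fin E) => x H xab.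
  by apply/matrixP => i j; exact: H.
- apply: ae_imply (ae_forall_fin (fun i => ae_forall_fin (off i))).
  move=> z H [z1 z2]; apply/matrixP => i j.
  by apply/eqP; rewrite -subr_eq0 H.
- split.
  + have := ae_forall_fin (fun i => ae_forall_fin (fun j => (diag i j).1)).
    apply: ae_imply => x H xab; apply/matrixP => i j.
    by apply/eqP; rewrite -subr_eq0 H.
  (* On the open lower triangle [fullker] is [N1], and on the upper one [N2]: exactly where [eq_N1D]
     compares them. *)
  + apply: ae_imply fullE => z H [z1 z2 z12].
    have := H z1 z2; rewrite /fullker /kI z12 ltNge (ltW z12)/=.
    by rewrite !scale1r !scale0r !addr0.
  + apply: ae_imply fullE => z H [z1 z2 z12].
    have := H z1 z2; rewrite /fullker /kI z12 ltNge (ltW z12)/=.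
    by rewrite !scale1r !scale0r !add0r.
Qed.

End uniqueness_N011.

(** * Linearity *)

Section linearity.
Context (R : realType).
Implicit Types a b c d k x theta : R.
Local Notation mu := (@lebesgue_measure R).

Lemma lin_addACA (V : lmodType R) k (A B A' B' : V) :
  (k *: A + A') + (k *: B + B') = k *: (A + B) + (A' + B').
Proof. by rewrite scalerDr addrACA. Qed.

Lemma lin_sum (V : lmodType R) (I : finType) k (A B : I -> V) :
  \sum_i (k *: A i + B i) = k *: (\sum_i A i) + \sum_i B i.
Proof. by rewrite big_split scaler_sumr. Qed.

Lemma kerE_lin n m k (N N' : par1D R n m) i s t :
  ker (lin1D k N N') i s t = k *: ker N i s t + ker N' i s t.
Proof. by case: i => [|[|]]. Qed.

(** Rows and columns differ at index 0: a row of [N0] is constant in [sigma], hence L2, while a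
    column is [N0] itself, whose membership is a hypothesis of [L2_on_ker_col]. *)
Lemma L2_on_ker_row n m a b (N : par1D R n m) x :
  L2_on a b (N1 N x) -> L2_on a b (N2 N x) -> forall i, L2_on a b (ker N i x).
Proof. by move=> N12 N22 [|[|i]] //=; exact: L2_on_cst. Qed.

Lemma L2_on_ker_col n m a b (N : par1D R n m) theta : L2_on a b (N0 N) ->
  L2_on a b (fun eta => N1 N eta theta) ->
  L2_on a b (fun eta => N2 N eta theta) ->
  forall i, L2_on a b (fun eta => ker N i eta theta).
Proof. by move=> N02 N12 N22 [|[|i]]. Qed.

Lemma mxint_lin n p m a b k (F F' : R -> 'M[R]_(n, p))
    (G G' : R -> 'M[R]_(p, m)) :
  L2_on a b F -> L2_on a b G -> L2_on a b F' -> L2_on a b G' ->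
  mxint `[a, b] (fun s => k *: (F s *m G s) + F' s *m G' s) =
  k *: mxint `[a, b] (fun s => F s *m G s)
  + mxint `[a, b] (fun s => F' s *m G' s).
Proof.
move=> F2 G2 F'2 G'2; have iFG := mx_integrableM F2 G2.
by rewrite mxintD ?mxintZ//; [exact: mx_integrableZ|exact: mx_integrableM].
Qed.

Lemma mxint_linl n p m a b k (F F' : R -> 'M[R]_(n, p)) (G : R -> 'M[R]_(p, m)) :
  L2_on a b F -> L2_on a b F' -> L2_on a b G ->
  mxint `[a, b] (fun s => (k *: F s + F' s) *m G s) =
  k *: mxint `[a, b] (fun s => F s *m G s) + mxint `[a, b] (fun s => F' s *m G s).
Proof.
move=> F2 F'2 G2; rewrite -mxint_lin//; apply: eq_mxint => s _.
by rewrite mulmxDl scalemxAl.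
Qed.

Lemma mxint_linr n p m a b k (F : R -> 'M[R]_(n, p)) (G G' : R -> 'M[R]_(p, m)) :
  L2_on a b F -> L2_on a b G -> L2_on a b G' ->
  mxint `[a, b] (fun s => F s *m (k *: G s + G' s)) =
  k *: mxint `[a, b] (fun s => F s *m G s) + mxint `[a, b] (fun s => F s *m G' s).
Proof.
move=> F2 G2 G'2; rewrite -mxint_lin//; apply: eq_mxint => s _.
by rewrite mulmxDr scalemxAr.
Qed.

Lemma kint_linl n p m a b (K : Defs.kernel R) k (F F' : R -> 'M[R]_(n, p))
    (G : R -> 'M[R]_(p, m)) : bounded_kernel K ->
  L2_on a b F -> L2_on a b F' -> L2_on a b G ->
  kint a b K (fun s => (k *: F s + F' s) *m G s) =
  k *: kint a b K (fun s => F s *m G s) + kint a b K (fun s => F' s *m G s).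
Proof.
move=> bK F2 F'2 G2; rewrite -kint_lin//; congr kint; apply/funext => s.
by rewrite mulmxDl scalemxAl.
Qed.

Lemma kint_linr n p m a b (K : Defs.kernel R) k (F : R -> 'M[R]_(n, p))
    (G G' : R -> 'M[R]_(p, m)) : bounded_kernel K ->
  L2_on a b F -> L2_on a b G -> L2_on a b G' ->
  kint a b K (fun s => F s *m (k *: G s + G' s)) =
  k *: kint a b K (fun s => F s *m G s) + kint a b K (fun s => F s *m G' s).
Proof.
move=> bK F2 G2 G'2; rewrite -kint_lin//; congr kint; apply/funext => s.
by rewrite mulmxDr scalemxAr.
Qed.

Lemma mul_ker_linl n p m a b k (F F' : R -> 'M[R]_(n, p))
    (N : par1D R p m) theta :
  L2_on a b F -> L2_on a b F' ->
  (forall i, L2_on a b (fun eta => ker N i eta theta)) ->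
  mul_ker a b (fun eta => k *: F eta + F' eta) N theta =
  k *: mul_ker a b F N theta + mul_ker a b F' N theta.
Proof.
move=> F2 F'2 N2; rewrite /mul_ker -lin_sum; apply: eq_bigr => i _.
by rewrite kint_linl//; exact: bounded_Phi_fst.
Qed.

Lemma mul_ker_linr n p m a b k (F : R -> 'M[R]_(n, p))
    (N N' : par1D R p m) theta :
  L2_on a b F -> (forall i, L2_on a b (fun eta => ker N i eta theta)) ->
  (forall i, L2_on a b (fun eta => ker N' i eta theta)) ->
  mul_ker a b F (lin1D k N N') theta =
  k *: mul_ker a b F N theta + mul_ker a b F N' theta.
Proof.
move=> F2 N2 N'2; rewrite /mul_ker -lin_sum; apply: eq_bigr => i _.
rewrite -kint_linr//; last exact: bounded_Phi_fst.
by congr kint; apply/funext => s; rewrite kerE_lin.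
Qed.

Lemma ker_mul_linl n p m a b k (N N' : par1D R n p) (G : R -> 'M[R]_(p, m)) x :
  (forall i, L2_on a b (ker N i x)) -> (forall i, L2_on a b (ker N' i x)) ->
  L2_on a b G ->
  ker_mul a b (lin1D k N N') G x = k *: ker_mul a b N G x + ker_mul a b N' G x.
Proof.
move=> N2 N'2 G2; rewrite /ker_mul -lin_sum; apply: eq_bigr => i _.
rewrite -kint_linl//; last exact: bounded_Phi_snd.
by congr kint; apply/funext => s; rewrite kerE_lin.
Qed.

Lemma ker_mul_linr n p m a b k (N : par1D R n p) (G G' : R -> 'M[R]_(p, m)) x :
  (forall i, L2_on a b (ker N i x)) -> L2_on a b G -> L2_on a b G' ->
  ker_mul a b N (fun eta => k *: G eta + G' eta) x =
  k *: ker_mul a b N G x + ker_mul a b N G' x.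
Proof.
move=> N2 G2 G'2; rewrite /ker_mul -lin_sum; apply: eq_bigr => i _.
by rewrite kint_linr//; exact: bounded_Phi_snd.
Qed.

Lemma ker_ker_linl n p m a b k l (N N' : par1D R n p) (M : par1D R p m) x theta :
  (forall i, L2_on a b (ker N i x)) -> (forall i, L2_on a b (ker N' i x)) ->
  (forall i, L2_on a b (fun eta => ker M i eta theta)) ->
  ker_ker a b l (lin1D k N N') M x theta =
  k *: ker_ker a b l N M x theta + ker_ker a b l N' M x theta.
Proof.
move=> N2 N'2 M2; rewrite /ker_ker -lin_sum; apply: eq_bigr => i _.
rewrite -lin_sum; apply: eq_bigr => j _.
rewrite -kint_linl//; last exact: bounded_Psi.
by congr kint; apply/funext => s; rewrite kerE_lin.
Qed.

Lemma ker_ker_linr n p m a b k l (N : par1D R n p) (M M' : par1D R p m) x theta :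
  (forall i, L2_on a b (ker N i x)) ->
  (forall i, L2_on a b (fun eta => ker M i eta theta)) ->
  (forall i, L2_on a b (fun eta => ker M' i eta theta)) ->
  ker_ker a b l N (lin1D k M M') x theta =
  k *: ker_ker a b l N M x theta + ker_ker a b l N M' x theta.
Proof.
move=> N2 M2 M'2; rewrite /ker_ker -lin_sum; apply: eq_bigr => i _.
rewrite -lin_sum; apply: eq_bigr => j _.
rewrite -kint_linr//; last exact: bounded_Psi.
by congr kint; apply/funext => s; rewrite kerE_lin.
Qed.

Section L011_linear.
Context (n0 p0 m0 n1 p1 m1 : nat) (a b c d k : R).

Lemma half_row n0' m0' n1' m1' (Q : par011 R n0' m0' n1' m1') :
  half_N011 a b c d Q -> {ae mu, forall x, x \in `[a, b] ->
    (forall i, L2_on a b (ker (B11 Q) i x)) /\ L2_on c d (B12 Q x)}.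
Proof.
move=> hQ; apply: ae_imply (half_section hQ) => x H xab.
by have [? ? ? ?] := H xab; split=> //; exact: L2_on_ker_row.
Qed.

Lemma N1D_col n m e f (N : par1D R n m) : in_N1D e f N ->
  {ae mu, forall theta, theta \in `[e, f] ->
    forall i, L2_on e f (fun eta => ker N i eta theta)}.
Proof.
move=> N2; apply: ae_imply (N1D_section2 N2) => t H tab.
by have [? ?] := H tab; case: N2 => *; exact: L2_on_ker_col.
Qed.

(** The formulas are linear at every point where their integrals are additive: it suffices that row
    [x] of the left factors and column [theta] of the right one be L2. This holds for almost every
    pair, a null set of rows or columns being null in the product. *)
Lemma half_L011_linl (B B' : par011 R n0 p0 n1 p1) (D : par011 R p0 m0 p1 m1) :
  in_N011 a b c d B -> in_N011 a b c d B' -> in_N011 a b c d D ->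
  half_eq_N011 a b c d (L011 a b c d (lin011 k B B') D)
    (lin011 k (L011 a b c d B D) (L011 a b c d B' D)).
Proof.
move=> /in_N011_half[hB hB'] /in_N011_half[hC hC'] /in_N011_half[hD hD'].
have [B01_2 B10_2 B12_2 B11_2] := hB; have [C01_2 C10_2 C12_2 C11_2] := hC.
have [B02_2 _ _ _] := hB'; have [C02_2 _ _ _] := hC'.
have [D01_2 D10_2 D12_2 D11_2] := hD; have [D02_2 D20_2 D21_2 D22_2] := hD'.
have rB := half_row hB; have rC := half_row hC.
have c11 := N1D_col D11_2; have c22 := N1D_col D22_2.
have c12 := L2_on2_section (L2_on2_swap D12_2).
have c21 := L2_on2_section (L2_on2_swap D21_2).
have kE l : {ae (mu \x mu)%E, forall z, z.1 \in `[a, b] -> z.2 \in `[a, b] ->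
    R11_formula a b c d (lin011 k B B') D l z.1 z.2 =
    k *: R11_formula a b c d B D l z.1 z.2 + R11_formula a b c d B' D l z.1 z.2}.
  apply: ae_imply2 (ae_imply2 _ (ae_prod1 mu rB) (ae_prod1 mu rC))
    (ae_imply2 _ (ae_prod2 mu c11) (ae_prod2 mu c21)); last 2 first.
  - by move=> z h1 h2; exact: (conj h1 h2).
  - by move=> z h1 h2; exact: (conj h1 h2).
  move=> [x t] /= [rBx rCx] [c11t c21t] xab tab.
  have [Bx Bx'] := rBx xab; have [Cx Cx'] := rCx xab.
  rewrite /R11_formula /= ker_ker_linl//; last exact: c11t.
  rewrite mxint_linl//; last exact: c21t.
  rewrite mulmxDl -scalemxAl lin_addACA scalerDr scalerA mulrC -scalerA.
  by rewrite lin_addACA.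
split.
- apply: ae_imply2 c11 c21 => t c11t c21t tab /=.
  rewrite mul_ker_linl//; last exact: c11t.
  rewrite mxint_linl//; last exact: c21t.
  by rewrite mulmxDl -scalemxAl !lin_addACA.
- apply: ae_imply2 rB rC => x rBx rCx xab /=.
  have [Bx Bx'] := rBx xab; have [Cx Cx'] := rCx xab.
  rewrite ker_mul_linl// mxint_linl//.
  by rewrite mulmxDl -scalemxAl !lin_addACA.
- apply: ae_imply2 (ae_imply2 _ (ae_prod1 mu rB) (ae_prod1 mu rC))
    (ae_imply2 _ (ae_prod2 mu c22) (ae_prod2 mu c12)); last 2 first.
  + by move=> z h1 h2; exact: (conj h1 h2).
  + by move=> z h1 h2; exact: (conj h1 h2).
  move=> [x t] /= [rBx rCx] [c22t c12t] [xab tab].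
  have [Bx Bx'] := rBx xab; have [Cx Cx'] := rCx xab.
  rewrite (ker_mul_linl k Bx Cx (c12t tab)).
  rewrite (mul_ker_linl k Bx' Cx' (c22t tab)).
  by rewrite mulmxDl -scalemxAl !lin_addACA.
- split.
  (* R_11^0 is a pointwise product without integrals, so linearity holds at each [x]. *)
  + apply: aeW => x _ /=.
    rewrite /R11_formula !ker_ker0E /eps eqxx !scale0r !addr0 /=.
    by rewrite mulmxDl -scalemxAl.
  + by apply: ae_imply (kE 1%N) => z H [z1 z2 _]; exact: H.
  + by apply: ae_imply (kE 2%N) => z H [z1 z2 _]; exact: H.
Qed.

Lemma half_L011_linr (B : par011 R n0 p0 n1 p1) (D D' : par011 R p0 m0 p1 m1) :
  in_N011 a b c d B -> in_N011 a b c d D -> in_N011 a b c d D' ->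
  half_eq_N011 a b c d (L011 a b c d B (lin011 k D D'))
    (lin011 k (L011 a b c d B D) (L011 a b c d B D')).
Proof.
move=> /in_N011_half[hB hB'] /in_N011_half[hD hD'] /in_N011_half[hE hE'].
have [B01_2 B10_2 B12_2 B11_2] := hB; have [B02_2 _ _ _] := hB'.
have [D01_2 D10_2 D12_2 D11_2] := hD; have [D02_2 D20_2 D21_2 D22_2] := hD'.
have [E01_2 E10_2 E12_2 E11_2] := hE; have [E02_2 E20_2 E21_2 E22_2] := hE'.
have rB := half_row hB.
(* All column conditions for one variable at once; used for [theta] with D_11 and D_21, and for [nu]
   with D_22 and D_12. *)
have col (e f e' f' : R) n m p q (N N' : par1D R n m)
    (G G' : R -> R -> 'M[R]_(p, q)) :
    in_N1D e f N -> in_N1D e f N' -> L2_on2 e' f' e f G -> L2_on2 e' f' e f G' ->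
    {ae mu, forall t, t \in `[e, f] ->
      [/\ forall i, L2_on e f (fun eta => ker N i eta t),
          forall i, L2_on e f (fun eta => ker N' i eta t),
          L2_on e' f' (fun s => G s t) & L2_on e' f' (fun s => G' s t)]}.
  move=> N2 N'2 G2 G'2.
  apply: ae_imply3 (N1D_col N2) (N1D_col N'2) (ae_imply2 _
    (L2_on2_section (L2_on2_swap G2)) (L2_on2_section (L2_on2_swap G'2)));
    last by move=> t h1 h2; exact: (conj h1 h2).
  by move=> t h1 h2 [h3 h4] te; split; [exact: h1|exact: h2|exact: h3|exact: h4].
have c1 := col _ _ _ _ _ _ _ _ _ _ _ _ D11_2 E11_2 D21_2 E21_2.
have c2 := col _ _ _ _ _ _ _ _ _ _ _ _ D22_2 E22_2 D12_2 E12_2.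
have kE l : {ae (mu \x mu)%E, forall z, z.1 \in `[a, b] -> z.2 \in `[a, b] ->
    R11_formula a b c d B (lin011 k D D') l z.1 z.2 =
    k *: R11_formula a b c d B D l z.1 z.2 + R11_formula a b c d B D' l z.1 z.2}.
  apply: ae_imply2 (ae_prod1 mu rB) (ae_prod2 mu c1).
  move=> [x t] /= rBx c1t xab tab.
  have [Bx Bx'] := rBx xab; have [Nt N't Gt G't] := c1t tab.
  rewrite /R11_formula /= ker_ker_linr// mxint_linr//.
  rewrite mulmxDr -scalemxAr lin_addACA scalerDr scalerA mulrC -scalerA.
  by rewrite lin_addACA.
split.
- apply: ae_imply c1 => t c1t tab /=; have [Nt N't Gt G't] := c1t tab.
  rewrite mul_ker_linr// mxint_linr//.
  by rewrite mulmxDr -scalemxAr !lin_addACA.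
- apply: ae_imply rB => x rBx xab /=; have [Bx Bx'] := rBx xab.
  rewrite ker_mul_linr// mxint_linr//.
  by rewrite mulmxDr -scalemxAr !lin_addACA.
- apply: ae_imply2 (ae_prod1 mu rB) (ae_prod2 mu c2).
  move=> [x t] /= rBx c2t [xab tab].
  have [Bx Bx'] := rBx xab; have [Nt N't Gt G't] := c2t tab.
  rewrite (ker_mul_linr k Bx Gt G't) (mul_ker_linr k Bx' Nt N't).
  by rewrite mulmxDr -scalemxAr !lin_addACA.
- split.
  + apply: aeW => x _ /=.
    rewrite /R11_formula !ker_ker0E /eps eqxx !scale0r !addr0 /=.
    by rewrite mulmxDr -scalemxAr.
  + by apply: ae_imply (kE 1%N) => z H [z1 z2 _]; exact: H.
  + by apply: ae_imply (kE 2%N) => z H [z1 z2 _]; exact: H.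
Qed.

End L011_linear.

Lemma swap_lin011 n0 m0 n1 m1 k (B B' : par011 R n0 m0 n1 m1) :
  swap011 (lin011 k B B') = lin011 k (swap011 B) (swap011 B').
Proof. by []. Qed.

Lemma L011_linl n0 p0 m0 n1 p1 m1 a b c d k (B B' : par011 R n0 p0 n1 p1)
    (D : par011 R p0 m0 p1 m1) :
  in_N011 a b c d B -> in_N011 a b c d B' -> in_N011 a b c d D ->
  eq_N011 a b c d (L011 a b c d (lin011 k B B') D)
    (lin011 k (L011 a b c d B D) (L011 a b c d B' D)).
Proof.
move=> B2 B'2 D2; apply/eq_N011_half; split; last 2 first.
- exact: half_L011_linl.
- rewrite L011_swap !swap_lin011 !L011_swap.
  by apply: half_L011_linl; exact: in_N011_swap.
have [[B01_2 B02_2 _ _] _] := B2; have [[C01_2 C02_2 _ _] _] := B'2.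
have [[_ _ D10_2 D20_2] _] := D2.
rewrite /L011 /lin011; cbn [B00 B01 B02].
rewrite (mxint_linl k B01_2 C01_2 D10_2) (mxint_linl k B02_2 C02_2 D20_2).
by rewrite mulmxDl -scalemxAl !lin_addACA.
Qed.

Lemma L011_linr n0 p0 m0 n1 p1 m1 a b c d k (B : par011 R n0 p0 n1 p1)
    (D D' : par011 R p0 m0 p1 m1) :
  in_N011 a b c d B -> in_N011 a b c d D -> in_N011 a b c d D' ->
  eq_N011 a b c d (L011 a b c d B (lin011 k D D'))
    (lin011 k (L011 a b c d B D) (L011 a b c d B D')).
Proof.
move=> B2 D2 D'2; apply/eq_N011_half; split; last 2 first.
- exact: half_L011_linr.
- rewrite L011_swap !swap_lin011 !L011_swap.
  by apply: half_L011_linr; exact: in_N011_swap.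
have [[B01_2 B02_2 _ _] _] := B2; have [[_ _ D10_2 D20_2] _] := D2.
have [[_ _ E10_2 E20_2] _] := D'2.
rewrite /L011 /lin011; cbn [B00 B10 B20].
rewrite (mxint_linr k B01_2 D10_2 E10_2) (mxint_linr k B02_2 D20_2 E20_2).
by rewrite mulmxDr -scalemxAr !lin_addACA.
Qed.

End linearity.

(** * The composition theorem *)

Lemma L011_existence (R : realType) (a b c d : R) (n0 n1 p0 p1 m0 m1 : nat)
    (B : par011 R n0 p0 n1 p1) (D : par011 R p0 m0 p1 m1) :
  in_N011 a b c d B -> RL2_operator a b c d B ->
  in_N011 a b c d D -> RL2_operator a b c d D ->
  [/\ in_N011 a b c d (L011 a b c d B D),
      RL2_operator a b c d (L011 a b c d B D)
    & composes a b c d B D (L011 a b c d B D)].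
Proof.
move=> B2 BL2 D2 DL2.
have B2' := in_N011_swap B2; have D2' := in_N011_swap D2.
have mB11 := RL2_multiplier B2 BL2.
have mB22 := RL2_multiplier B2' (RL2_operator_swap BL2).
have mD11 := RL2_multiplier D2 DL2.
have mD22 := RL2_multiplier D2' (RL2_operator_swap DL2).
have L2 : in_N011 a b c d (L011 a b c d B D).
  apply/in_N011_half; split; first exact: half_L011.
  by rewrite L011_swap; exact: half_L011.
split=> //.
(* The diagonal parameters of the composite are products of multipliers, hence multipliers, which
   makes the composite an operator on L2. The dimensions and endpoints are generalized so that the
   same identity serves after the exchange of variables. *)
- have N0E (x : R) q0 q1 r0 r1 s0 s1 (a' b' c' d' : R)
      (B' : par011 R q0 r0 q1 r1) (D' : par011 R r0 s0 r1 s1) :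
      N0 (B11 (L011 a' b' c' d' B' D')) x = N0 (B11 B') x *m N0 (B11 D') x.
    by rewrite /= /R11_formula ker_ker0E /eps eqxx scale0r addr0.
  apply: RL2_operator_of_multiplier => //.
  + rewrite (_ : N0 _ = fun x => N0 (B11 B) x *m N0 (B11 D) x).
      exact: multiplierM.
    by apply/funext => x; exact: N0E.
  + rewrite (_ : N0 _ = fun x => N0 (B22 B) x *m N0 (B22 D) x).
      exact: multiplierM.
    apply/funext => x; rewrite -[B22 _]/(B11 (swap011 (L011 a b c d B D))).
    by rewrite L011_swap N0E.
- move=> u u_2; have Du_2 := DL2 u u_2; split.
  + exact: u0_P011_L011.
  + exact: u1_P011_L011.
  (* The third component is the second one of the exchanged operators. *)
  + have := u1_P011_L011 B2' D2' mD22 mD11 (in_RL2_swap u_2).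
    rewrite P011_swap => /(_ (in_RL2_swap Du_2)).
    by rewrite -L011_swap !P011_swap; apply; exact: in_N011_swap.
Qed.

(** Two parameters representing the same composite define the same operator up to null sets.
    [half_unique] then applies as such for the first half of the parameters and to the exchanged
    operators for the second. *)
Lemma composes_unique (R : realType) (a b c d : R) (n0 n1 p0 p1 m0 m1 : nat)
    (B : par011 R n0 p0 n1 p1) (D : par011 R p0 m0 p1 m1)
    (Q Q' : par011 R n0 m0 n1 m1) :
  in_N011 a b c d Q -> in_N011 a b c d Q' ->
  composes a b c d B D Q -> composes a b c d B D Q' -> eq_N011 a b c d Q' Q.
Proof.
move=> Q2 Q'2 BDQ BDQ'.
have eqP (u : state R m0 m1) : in_RL2 a b c d u ->
    eq_RL2 a b c d (P011 a b c d Q' u) (P011 a b c d Q u).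
  move=> u_2; have [e0 e1 e2] := BDQ u u_2; have [f0 f1 f2] := BDQ' u u_2.
  split; first by rewrite -e0 f0.
  - by apply: ae_imply2 e1 f1 => x ex fx xab; rewrite -fx// ex.
  - by apply: ae_imply2 e2 f2 => x ex fx xab; rewrite -fx// ex.
have [e00 half1] := half_unique Q'2 Q2 (fun u u_2 =>
  let: And3 h0 h1 _ := eqP u u_2 in conj h0 h1).
apply/eq_N011_half; split=> //.
apply: (half_unique (in_N011_swap Q'2) (in_N011_swap Q2) _).2 => u u_2.
have -> : u = swap_state (swap_state u) by case: u {u_2}.
by rewrite !P011_swap; have [? _ ?] := eqP _ (in_RL2_swap u_2).
Qed.

Theorem lemma2 (R : realType) (a b c d : R) (hab : a < b) (hcd : c < d)
    (n0 n1 p0 p1 m0 m1 : nat) :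
  (* existence, uniqueness, and the explicit formula *)
  (forall (B : par011 R n0 p0 n1 p1) (D : par011 R p0 m0 p1 m1),
    in_N011 a b c d B -> RL2_operator a b c d B ->
    in_N011 a b c d D -> RL2_operator a b c d D ->
    (exists Q : par011 R n0 m0 n1 m1,
      [/\ in_N011 a b c d Q,
          RL2_operator a b c d Q,
          composes a b c d B D Q
        & forall Q' : par011 R n0 m0 n1 m1,
            in_N011 a b c d Q' -> composes a b c d B D Q' ->
            eq_N011 a b c d Q' Q]) /\
    [/\ in_N011 a b c d (L011 a b c d B D),
        RL2_operator a b c d (L011 a b c d B D)
      & composes a b c d B D (L011 a b c d B D)]) /\
  (* linearity of the parameter map in each argument *)
  (forall (k : R) (B B' : par011 R n0 p0 n1 p1) (D : par011 R p0 m0 p1 m1),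
    in_N011 a b c d B -> in_N011 a b c d B' -> in_N011 a b c d D ->
    eq_N011 a b c d (L011 a b c d (lin011 k B B') D)
      (lin011 k (L011 a b c d B D) (L011 a b c d B' D))) /\
  (forall (k : R) (B : par011 R n0 p0 n1 p1) (D D' : par011 R p0 m0 p1 m1),
    in_N011 a b c d B -> in_N011 a b c d D -> in_N011 a b c d D' ->
    eq_N011 a b c d (L011 a b c d B (lin011 k D D'))
      (lin011 k (L011 a b c d B D) (L011 a b c d B D'))).
Proof.
split=> [B D B2 BL2 D2 DL2|]; last first.
  by split=> k *; [exact: L011_linl|exact: L011_linr].
have [L2 LL2 Lcomp] := L011_existence B2 BL2 D2 DL2.
split=> //; exists (L011 a b c d B D); split=> // Q' Q'2 Q'comp.
exact: (composes_unique L2 Q'2 Lcomp Q'comp).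
Qed.
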